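(* Let $K=2$ and consider elliptical electorates with covariance matrix $$\Sigma(\varrho)=\begin{pmatrix}\sigma_1^2&\varrho\sigma_1\sigma_2\\ \varrho\sigma_1\sigma_2&\sigma_2^2\end{pmatrix},\qquad \sigma_1,\sigma_2>0,\ |\varrho|<1,$$ in the platform game of the context. Hold fixed the center $\mu$, the standardized projection distribution $H$, the variances $\sigma_1^2,\sigma_2^2$, $\phi$ and $\nu$, and restrict attention to values of $\varrho$ for which $\phi>4R(\varrho)^2$, where $R(\varrho)$ is the support radius. Then a strict increase in $|\varrho|$ strictly increases the distance $\|x_A-x_B\|$ between the party-preferred equilibrium platforms and strictly raises both parties' payoffs at party-preferred equilibria.
   Context: For each admissible $\varrho$, voter bliss points follow a distribution $\mathcal P_\varrho$ on $\mathbb R^2$ equal to the law of $\mu+\Sigma(\varrho)^{1/2}Z$, where $Z$ is a fixed spherically symmetric random vector with identity covariance; thus every centered projection $e^\top(X-\mu)$ ($\|e\|=1$) has quantile function $\sqrt{e^\top\Sigma(\varrho)e}\,H^{-1}(u)$ with $H$ common to all $e$ and $\varrho$. $\mathcal P_\varrho$ is absolutely continuous with compact support, every one-dimensional projection has a cdf strictly increasing between the extrema of its support, and $R(\varrho)=\sup_{x\in\operatorname{supp}\mathcal P_\varrho}\|x-\mu\|$. Parties $A,B$ simultaneously choose platforms $x_A,x_B\in\mathbb R^2$. A voter with bliss point $x$ supports $A$ iff $\|x_B-x\|^2-\|x_A-x\|^2\ge\epsilon$, where the common shock $\epsilon$ is uniform on $[-\phi,\phi]$. $S_A(\epsilon)$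 is the mass of voters supporting $A$ and $S_B=1-S_A$. The power rule $\rho:[0,1]\to\mathbb R$ is strictly increasing, with $\rho(s)+\rho(1-s)=\bar\rho$ for all $s$, and continuous at $0$ and $1$ (interior jumps allowed); $U:[\rho(0),\rho(1)]\to\mathbb R$ is continuous, strictly increasing and strictly concave; $\nu=U\circ\rho$ with $\nu(1)-\nu(0)=1$. Payoffs are $V_p(x_A,x_B)=\mathbb E_\epsilon[\nu(S_p(\epsilon))]$. A pure-strategy Nash equilibrium is party-preferred if it maximizes each party's payoff among all pure-strategy Nash equilibria; such equilibria exist and, for a given electorate, all have the same platform distance and payoffs. *)

(* Defs.v *)
From HB Require Import structures.
From mathcomp Require Import all_boot all_order all_algebra.
From mathcomp Require Import all_classical all_reals all_analysis.
Export numFieldNormedType.Exports.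

Set Implicit Arguments.
Unset Strict Implicit.
Unset Printing Implicit Defensive.

Import Order.TTheory GRing.Theory Num.Theory.

Local Open Scope classical_set_scope.
Local Open Scope ring_scope.

(* The plane is [R * R], which carries the product topology and the product
   sigma-algebra. Its library norm is the sup norm, so the Euclidean norm is
   defined here. *)
Section Plane.
Context {R : realType}.

Definition dot (x y : R * R) : R := x.1 * y.1 + x.2 * y.2.

Definition enorm (x : R * R) : R := Num.sqrt (dot x x).

Definition mulmxv (M : 'M[R]_2) (x : R * R) : R * R :=
  (M 0 0 * x.1 + M 0 1 * x.2, M 1 0 * x.1 + M 1 1 * x.2).

Definition psdmx (M : 'M[R]_2) : Prop :=
  M^T = M /\ forall x : R * R, 0 <= dot x (mulmxv M x).

(* The unique positive semidefinite square root of a positive semidefinite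
   matrix (a junk value for any other matrix). *)
Definition sqrtmx (M : 'M[R]_2) : 'M[R]_2 :=
  xget 0 [set S : 'M[R]_2 | psdmx S /\ S *m S = M].

Definition covmx (s1 s2 r : R) : 'M[R]_2 :=
  \matrix_(i < 2, j < 2)
    if i == j then (if i == 0 then s1 ^+ 2 else s2 ^+ 2) else r * s1 * s2.

End Plane.

Section Laws.
Context {R : realType}.

Definition law_support {T : topologicalType} (m : set T -> \bar R) : set T :=
  [set x | forall O : set T, open O -> O x -> (0 < m O)%E].

Definition spherically_symmetric (m : set (R * R) -> \bar R) : Prop :=
  forall Q : 'M[R]_2, Q *m Q^T = 1%:M ->
  forall B : set (R * R), measurable B -> m (mulmxv Q @^-1` B) = m B.

Definition projection_law (m : set (R * R) -> \bar R) (e : R * R) :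
    set R -> \bar R :=
  pushforward m (dot e).

Definition increasing_projection_cdf (m : set (R * R) -> \bar R)
    (e : R * R) : Prop :=
  let p := projection_law m e in
  forall s t : R, inf (law_support p) <= s -> s < t ->
    t <= sup (law_support p) ->
    (p `]-oo, s]%classic < p `]-oo, t]%classic)%E.

Definition regular_electorate (m : set (R * R) -> \bar R) : Prop :=
  [/\ m `<< (lebesgue_measure \x lebesgue_measure)%E,
      compact (law_support m) &
      forall e : R * R, enorm e = 1 -> increasing_projection_cdf m e].

Definition support_radius (mu : R * R) (m : set (R * R) -> \bar R) : R :=
  sup [set enorm (x - mu) | x in law_support m].

End Laws.

Section Electorate.
Context {d : measure_display} {T : measurableType d} {R : realType}.
Variable P : probability T R.

Definition identity_covariance (Z : T -> R * R) : Prop :=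
  [/\ covariance P (fst \o Z) (fst \o Z) = 1%E,
      covariance P (snd \o Z) (snd \o Z) = 1%E &
      covariance P (fst \o Z) (snd \o Z) = 0%E].

(* The law of [mu + Sigma(r)^(1/2) Z]. *)
Definition electorate (Z : T -> R * R) (mu : R * R) (s1 s2 r : R) :
    set (R * R) -> \bar R :=
  pushforward P (fun t => mu + mulmxv (sqrtmx (covmx s1 s2 r)) (Z t)).

End Electorate.

Section Primitives.
Context {R : realType}.

Definition strictly_concave_on (a b : R) (U : R -> R) : Prop :=
  forall x y t : R, x \in `[a, b] -> y \in `[a, b] -> x != y ->
    0 < t < 1 -> t * U x + (1 - t) * U y < U (t * x + (1 - t) * y).

(* Only the values of [rho] on [0, 1] matter, so continuity at the endpoints
   is one-sided. *)
Definition power_rule (rho : R -> R) : Prop :=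
  [/\ {in `[0, 1] &, {homo rho : s t / s < t}},
      exists rhobar : R,
        forall s, s \in `[0, 1] -> rho s + rho (1 - s) = rhobar,
      rho s @[s --> 0^'+] --> rho 0 &
      rho s @[s --> 1^'-] --> rho 1].

Definition utility_on (a b : R) (U : R -> R) : Prop :=
  [/\ {within `[a, b], continuous U},
      {in `[a, b] &, {homo U : x y / x < y}} &
      strictly_concave_on a b U].

End Primitives.

Section Game.
Context {R : realType}.

Lemma shock_range (phi : R) : 0 < phi -> - phi < phi.
Proof. by move=> phi0; rewrite (lt_trans _ phi0)// oppr_lt0. Qed.

(* [eps] is the realization of the common shock. *)
Definition share_A (m : set (R * R) -> \bar R) (xA xB : R * R) (eps : R) : R :=
  fine (m [set x | eps <= enorm (xB - x) ^+ 2 - enorm (xA - x) ^+ 2]).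

Definition payoff_A (m : set (R * R) -> \bar R) (phi : R) (phi0 : 0 < phi)
    (nu : R -> R) (xA xB : R * R) : R :=
  fine ('E_(uniform_prob (shock_range phi0))
         [fun eps => nu (share_A m xA xB eps)])%E.

Definition payoff_B (m : set (R * R) -> \bar R) (phi : R) (phi0 : 0 < phi)
    (nu : R -> R) (xA xB : R * R) : R :=
  fine ('E_(uniform_prob (shock_range phi0))
         [fun eps => nu (1 - share_A m xA xB eps)%R])%E.

Definition nash_equilibrium (VA VB : R * R -> R * R -> R)
    (xA xB : R * R) : Prop :=
  (forall y, VA y xB <= VA xA xB) /\ (forall y, VB xA y <= VB xA xB).

Definition party_preferred (VA VB : R * R -> R * R -> R)
    (xA xB : R * R) : Prop :=
  nash_equilibrium VA VB xA xB /\
  forall yA yB, nash_equilibrium VA VB yA yB ->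
    VA yA yB <= VA xA xB /\ VB yA yB <= VB xA xB.

End Game.

(* Main.v *)
Require Import Defs.
From HB Require Import structures.
From mathcomp Require Import all_boot all_order all_algebra.
From mathcomp Require Import all_classical all_reals all_analysis.
From mathcomp Require Import measurable_realfun ring lra.

Set Implicit Arguments.
Unset Strict Implicit.
Unset Printing Implicit Defensive.

Import Order.TTheory GRing.Theory Num.Theory.
Import numFieldNormedType.Exports.

Local Open Scope classical_set_scope.
Local Open Scope ring_scope.

(* Place the origin at [mu] and write [S] for the square root of the covariance
   matrix. Spherical symmetry makes [d . X] distributed as [|S d| Y] for a fixed
   atomless symmetric [Y]. When both platforms lie in the disc of radius
   [R(rho)], the bound [phi > 4 R^2] keeps every indifference threshold inside
   the shock interval, and integrating over the shock gives, up to an affine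
   normalization, [V(a, b) = |b|^2 - |a|^2 + 2 k |S (a - b)|], where [k] is the
   integral of [nu p + nu (1 - p) - nu 0 - nu 1] over [p = P(Y >= y)], [y > 0].
   Strict concavity gives [k > 0]. Equilibrium platforms lie in the disc, and the
   game with payoff [V] forces [a = - b] along an eigenvector, at distance
   [2 k sqrt lambda], each party's payoff being increasing in that distance. The
   top eigenvalue yields an equilibrium, hence the party-preferred one, and it
   increases strictly with [|rho|]. *)

(** * Plane geometry and the quadratic game *)

(** [k] is built from the first coordinate of [Z] alone, so one constant serves every correlation
    and the comparison reduces to eigenvalues. The surplus [nu p + nu (1 - p) - nu 0 - nu 1] is at
    most [1] and [Y <= R / sqrt lambda] almost surely; hence [k sqrt lambda <= R], which places the
    candidate equilibrium in the disc where the formula for [V] holds. The delicate point is the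
    exterior of the disc. Projection onto the disc weakly dominates, which settles deviations, but a
    dominated platform could remain a best response if voters were unanimous at almost every shock.
    Strictly increasing projection cdfs, together with the payoff guaranteed by imitation, exclude
    this. Since [nu] may jump, it is never differentiated: monotonicity supplies measurability, and
    the shock integral is folded about [0] so that [nu p + nu (1 - p)] appears. In the comparison,
    every equilibrium at the smaller correlation has distance at most [2 k sqrt lambda], while at
    the larger one party preference forces at least the distance of the equilibrium on the principal
    axis. *)

Section PlaneGeometry.
Context {R : realType}.
Implicit Types (x y z a b d : R * R) (S : 'M[R]_2) (t : R).

Lemma dotC x y : dot x y = dot y x.
Proof. by rewrite /dot [x.1 * _]mulrC [x.2 * _]mulrC. Qed.

Lemma dotDl x y z : dot (x + y) z = dot x z + dot y z.
Proof. by rewrite /dot /=; ring. Qed.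

Lemma dotBl x y z : dot (x - y) z = dot x z - dot y z.
Proof. by rewrite /dot /=; ring. Qed.

Lemma dotDr x y z : dot z (x + y) = dot z x + dot z y.
Proof. by rewrite /dot /=; ring. Qed.

Lemma dotBr x y z : dot z (x - y) = dot z x - dot z y.
Proof. by rewrite /dot /=; ring. Qed.

Lemma dotZl t x y : dot (t *: x) y = t * dot x y.
Proof. by rewrite /dot /= /GRing.scale /=; ring. Qed.

Lemma dotZr t x y : dot y (t *: x) = t * dot y x.
Proof. by rewrite /dot /= /GRing.scale /=; ring. Qed.

Lemma dotxx_ge0 x : 0 <= dot x x.
Proof. by rewrite /dot -!expr2 addr_ge0 ?sqr_ge0. Qed.

Lemma dotxx_eq0 x : (dot x x == 0) = (x == 0).
Proof.
case: x => x1 x2; rewrite /dot /= -!expr2 paddr_eq0 ?sqr_ge0//.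
by rewrite !sqrf_eq0.
Qed.

Lemma enorm_ge0 x : 0 <= enorm x.
Proof. exact: sqrtr_ge0. Qed.

Lemma sqr_enorm x : enorm x ^+ 2 = dot x x.
Proof. by rewrite sqr_sqrtr// dotxx_ge0. Qed.

Lemma enorm_eq0 x : (enorm x == 0) = (x == 0).
Proof. by rewrite -sqrf_eq0 sqr_enorm dotxx_eq0. Qed.

Lemma enorm_gt0 x : (0 < enorm x) = (x != 0).
Proof. by rewrite lt_def enorm_ge0 andbT enorm_eq0. Qed.

Lemma enorm0 : enorm (0 : R * R) = 0.
Proof. by apply/eqP; rewrite enorm_eq0. Qed.

Lemma enormB x y : enorm (x - y) = enorm (y - x).
Proof. by rewrite /enorm; congr Num.sqrt; rewrite /dot /=; ring. Qed.

Lemma enormZ t x : enorm (t *: x) = `|t| * enorm x.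
Proof.
by rewrite /enorm dotZl dotZr mulrA -expr2 sqrtrM ?sqr_ge0// sqrtr_sqr.
Qed.

Lemma enorm_le x t : 0 <= t -> (enorm x <= t) = (dot x x <= t ^+ 2).
Proof.
by move=> t0; rewrite -sqr_enorm ler_pXn2r ?nnegrE ?enorm_ge0.
Qed.

Lemma dot_le_enorm x y : dot x y <= enorm x * enorm y.
Proof.
apply: (le_trans (ler_norm _)).
rewrite -(@ler_pXn2r _ 2) ?nnegrE ?mulr_ge0 ?enorm_ge0//.
rewrite exprMn !sqr_enorm real_normK ?num_real// -subr_ge0.
have -> : dot x x * dot y y - dot x y ^+ 2 = (x.1 * y.2 - x.2 * y.1) ^+ 2.
  by rewrite /dot; ring.
exact: sqr_ge0.
Qed.

Lemma enormD x y : enorm (x + y) <= enorm x + enorm y.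
Proof.
rewrite enorm_le ?addr_ge0 ?enorm_ge0// sqrrD !sqr_enorm.
have := dot_le_enorm x y.
by rewrite !dotDl !dotDr (dotC y x); lra.
Qed.

Lemma mulmxvB S x y : mulmxv S (x - y) = mulmxv S x - mulmxv S y.
Proof. by congr pair; rewrite /=; ring. Qed.

Lemma mulmxvZ S t x : mulmxv S (t *: x) = t *: mulmxv S x.
Proof. by congr pair; rewrite /= /GRing.scale /=; ring. Qed.

Lemma mulmxvN S x : mulmxv S (- x) = - mulmxv S x.
Proof. by congr pair; rewrite /=; ring. Qed.

Lemma dot_mulmxv S x y : dot (mulmxv S x) y = dot x (mulmxv S^T y).
Proof. by rewrite /dot /mulmxv /= !mxE; ring. Qed.

Lemma mulmxvM S S' x : mulmxv (S *m S') x = mulmxv S (mulmxv S' x).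
Proof.
rewrite /mulmxv /= !mxE !big_ord_recl !big_ord0.
have -> : lift ord0 ord0 = 1 :> 'I_2 by exact: val_inj.
by congr pair; ring.
Qed.

(** The gain [t = |x - y|^2] is the same for all [z] of the disc, so moving a platform from [x] to
    [y] raises all margins by a common amount, positive when [x] lies outside. *)
Lemma disc_projection (r : R) x : 0 <= r ->
  exists y, enorm y <= r /\
    exists2 t, 0 <= t /\ (r < enorm x -> 0 < t) &
      forall z, enorm z <= r -> dot (y - z) (y - z) + t <= dot (x - z) (x - z).
Proof.
move=> r0; have [xr|rx] := leP (enorm x) r.
  exists x; split => //; exists 0; first by split.
  by move=> z _; rewrite addr0.
have nx0 : 0 < enorm x by exact: le_lt_trans rx.
set u := r / enorm x.
have u0 : 0 <= u by rewrite divr_ge0// ltW.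
have u1 : u < 1 by rewrite ltr_pdivrMr// mul1r.
have uE : u * enorm x = r by rewrite divfK ?gt_eqF.
exists (u *: x); split; first by rewrite enormZ ger0_norm// uE.
exists ((1 - u) ^+ 2 * dot x x).
  split; first by rewrite mulr_ge0 ?sqr_ge0 ?dotxx_ge0.
  move=> _; rewrite mulr_gt0//; first by rewrite exprn_gt0// subr_gt0.
  by rewrite -sqr_enorm exprn_gt0.
move=> z zr; have zx := dot_le_enorm x z.
have zx' : dot x z <= u * dot x x.
  rewrite -sqr_enorm expr2 mulrA uE (le_trans zx)// mulrC.
  by rewrite ler_wpM2r// ltW.
rewrite !dotBl !dotBr !dotZl !dotZr (dotC z x).
(* The slack in the goal is exactly twice this product. *)
have := mulr_ge0 (ltW (_ : 0 < 1 - u)) (_ : 0 <= u * dot x x - dot x z).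
rewrite subr_gt0 subr_ge0 => /(_ u1 zx').
set p := dot x x; set q := dot x z; set w := dot z z; nra.
Qed.

End PlaneGeometry.

Section QuadraticGame.
Context {R : realType}.
Variables (S : 'M[R]_2) (k r lambda : R).
Hypotheses (Ssym : S^T = S) (k_ge0 : 0 <= k) (lambda_ge0 : 0 <= lambda).
Hypothesis S_inj : forall d, d != 0 -> 0 < enorm (mulmxv S d).
Hypothesis S_le :
  forall d, dot (mulmxv S d) (mulmxv S d) <= lambda * dot d d.
Hypothesis kr : k * Num.sqrt lambda <= r.

Let s d := enorm (mulmxv S d).

Definition quadratic_payoff (a b : R * R) : R :=
  dot b b - dot a a + 2 * k * enorm (mulmxv S (a - b)).

Lemma mulmxv_sqrt_le d : enorm (mulmxv S d) <= Num.sqrt lambda * enorm d.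
Proof.
rewrite enorm_le ?mulr_ge0 ?sqrtr_ge0 ?enorm_ge0//.
by rewrite exprMn sqr_sqrtr// sqr_enorm.
Qed.

(** Gradient of [k s] at [d], by symmetry of [S]. Stationarity of [quadratic_payoff] in [a] reads
    [a = gradient (a - b)]. *)
Let gradient d := (k / s d) *: mulmxv S (mulmxv S d).

(** Best responses are tested only against the disc; this makes the gradient an admissible
    deviation. *)
Let gradient_le d : d != 0 -> enorm (gradient d) <= r.
Proof.
move=> /S_inj s0; apply: le_trans kr.
rewrite enormZ ger0_norm ?divr_ge0 ?(ltW s0)//.
rewrite -mulrA ler_wpM2l// mulrC ler_pdivrMr//.
exact: mulmxv_sqrt_le.
Qed.

Let dot_gradient d x :
  dot x (gradient d) = k / s d * dot (mulmxv S d) (mulmxv S x).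
Proof. by rewrite dotZr -{1}Ssym -dot_mulmxv dotC. Qed.

(* Convexity of [s] makes the deviation to the gradient gain at least
   [|gradient - a|^2]. *)
Lemma best_response_gradient a b : a != b ->
  (forall y, enorm y <= r -> quadratic_payoff y b <= quadratic_payoff a b) ->
  a = (k / enorm (mulmxv S (a - b))) *: mulmxv S (mulmxv S (a - b)).
Proof.
rewrite -subr_eq0 => ab0 /(_ _ (gradient_le ab0)).
rewrite -/(s (a - b)) -/(gradient (a - b)).
set d := a - b; set g := gradient d.
have s0 : 0 < s d := S_inj ab0.
(* Subgradient inequality: [k s d = dot d g], and Cauchy-Schwarz for [S d] and [S (g - b)] gives
   [dot (g - b) g <= k s (g - b)]. *)
have cvx : k * s d + dot (g - a) g <= k * s (g - b).
  have -> : k * s d = dot d g.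
    rewrite dot_gradient -sqr_enorm -/(s d).
    by field; rewrite gt_eqF.
  have -> : g - b = d + (g - a) by rewrite /d [RHS]addrC addrA subrK.
  rewrite -dotDl dot_gradient -mulrA ler_wpM2l// mulrC ler_pdivrMr//.
  by rewrite mulrC dot_le_enorm.
rewrite /quadratic_payoff -/(s (g - b)) -/d -/(s d) => dev.
apply/eqP; rewrite -subr_eq0 -dotxx_eq0 eq_le dotxx_ge0 andbT.
move: dev cvx; rewrite !dotBl !dotBr (dotC g a).
by set x := dot g g; set y := dot a a; set z := dot a g; lra.
Qed.

(** With [d = a - b], the two stationarity equations give [b = - a] and [2 k s(d) = |d|^2], which is
    the payoff; the bound on the distance follows from [s(d) <= sqrt lambda |d|]. *)
Lemma quadratic_equilibrium a b :
  (forall y, enorm y <= r -> quadratic_payoff y b <= quadratic_payoff a b) ->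
  (forall y, enorm y <= r -> quadratic_payoff y a <= quadratic_payoff b a) ->
  [/\ quadratic_payoff a b = enorm (a - b) ^+ 2,
      quadratic_payoff b a = enorm (a - b) ^+ 2 &
      enorm (a - b) <= 2 * k * Num.sqrt lambda].
Proof.
move=> brA brB; rewrite sqr_enorm.
have [ab|ab] := eqVneq a b.
  rewrite /quadratic_payoff ab !subrr.
  have -> : mulmxv S 0 = 0 by rewrite /mulmxv /= !mulr0 addr0.
  rewrite !enorm0 !mulr0 addr0; split => //.
    by rewrite /dot /=; ring.
    by rewrite /dot /=; ring.
  by rewrite !mulr_ge0 ?sqrtr_ge0.
have aE := best_response_gradient ab brA.
have bE := best_response_gradient (_ : b != a) brB.
rewrite eq_sym ab in bE; move/(_ isT) in bE.
have ab0 : a - b != 0 by rewrite subr_eq0.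
have s0 : 0 < s (a - b) := S_inj ab0.
have sE : enorm (mulmxv S (b - a)) = s (a - b).
  by rewrite /s mulmxvB [in RHS]mulmxvB enormB.
(* The gradient is odd and [b] is the gradient at [- (a - b)]. *)
have ba : b = - a.
  rewrite [in RHS]aE [LHS]bE sE -/(s (a - b)) -scalerN; congr (_ *: _).
  by rewrite -!mulmxvN opprB.
have dE : a - b = 2 *: a by rewrite ba opprK scaler_nat mulr2n.
(* Pair [a - b = 2 a] with the stationarity equation for [a]. *)
have sq : 2 * k * s (a - b) = dot (a - b) (a - b).
  rewrite [in X in dot _ X]dE dotZr.
  rewrite [X in dot _ X]aE -/(s (a - b)) -/(gradient (a - b)) dot_gradient.
  by rewrite -sqr_enorm -/(s (a - b)); field; rewrite gt_eqF.
have bb : dot b b = dot a a by rewrite ba /dot /=; ring.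
split.
- by rewrite /quadratic_payoff bb subrr add0r -/(s _) sq.
- by rewrite /quadratic_payoff bb subrr add0r sE sq.
rewrite -(ler_pM2r (_ : 0 < enorm (a - b))) ?enorm_gt0//.
rewrite -expr2 sqr_enorm -sq -[leRHS]mulrA ler_wpM2l ?mulr_ge0//.
exact: mulmxv_sqrt_le.
Qed.

(** Optimality is global: since [s(y + a) <= l (|y| + k l)] with [l = sqrt lambda], the payoff of
    [y] is at most [(2 k l)^2 - (|y| - k l)^2]. *)
Lemma principal_axis_equilibrium e : enorm e = 1 ->
    enorm (mulmxv S e) = Num.sqrt lambda ->
  let a := (k * Num.sqrt lambda) *: e in
  [/\ enorm a <= r,
      forall y, quadratic_payoff y (- a) <= quadratic_payoff a (- a) &
      quadratic_payoff a (- a) = (2 * k * Num.sqrt lambda) ^+ 2].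
Proof.
move=> e1 eS; set l := Num.sqrt lambda; set a := _ *: e => /=.
have l0 : 0 <= l by exact: sqrtr_ge0.
have nE : enorm a = k * l by rewrite enormZ e1 mulr1 ger0_norm ?mulr_ge0.
have val : quadratic_payoff a (- a) = (2 * k * l) ^+ 2.
  have aa : a + a = 2 *: a by rewrite scaler_nat mulr2n.
  rewrite /quadratic_payoff opprK aa mulmxvZ enormZ.
  rewrite /a mulmxvZ enormZ eS !ger0_norm ?mulr_ge0// /dot /=.
  by rewrite -/l; ring.
split => //; first by rewrite nE.
move=> y; rewrite val /quadratic_payoff opprK.
have -> : dot (- a) (- a) = (k * l) ^+ 2.
  by rewrite -nE sqr_enorm /dot /=; ring.
rewrite -sqr_enorm.
have h1 := mulmxv_sqrt_le (y + a).
have h2 := enormD y a; rewrite nE in h2.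
have : 2 * k * enorm (mulmxv S (y + a)) <= 2 * k * (l * (enorm y + k * l)).
  rewrite ler_wpM2l ?mulr_ge0// (le_trans h1)// ler_wpM2l//.
have := sqr_ge0 (enorm y - k * l).
set n := enorm y; set w := enorm _; rewrite !expr2; lra.
Qed.

End QuadraticGame.

(** * Covariance matrices *)

Section Covariance.
Context {R : realType}.
Implicit Types (r : R) (x : R * R).

Lemma ord2_cases (i : 'I_2) : i = 0 \/ i = 1.
Proof. by case: i => [[|[|//]] i2]; [left|right]; exact: val_inj. Qed.

Lemma mx2P (A B : 'M[R]_2) : A 0 0 = B 0 0 -> A 0 1 = B 0 1 ->
  A 1 0 = B 1 0 -> A 1 1 = B 1 1 -> A = B.
Proof.
move=> h00 h01 h10 h11; apply/matrixP => i j.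
by case: (ord2_cases i) => ->; case: (ord2_cases j) => ->.
Qed.

Lemma covmxE (s1 s2 : R) r : [/\ covmx s1 s2 r 0 0 = s1 ^+ 2,
  covmx s1 s2 r 0 1 = r * s1 * s2, covmx s1 s2 r 1 0 = r * s1 * s2 &
  covmx s1 s2 r 1 1 = s2 ^+ 2].
Proof. by split; rewrite mxE. Qed.

Lemma mulmx2E (A B : 'M[R]_2) i j :
  (A *m B) i j = A i 0 * B 0 j + A i 1 * B 1 j.
Proof.
rewrite mxE !big_ord_recl big_ord0 addr0.
by have -> : lift ord0 ord0 = 1 :> 'I_2 by exact: val_inj.
Qed.

Lemma dot_covmx (s1 s2 : R) r x : dot x (mulmxv (covmx s1 s2 r) x) =
  s1 ^+ 2 * x.1 ^+ 2 + 2 * (r * s1 * s2) * (x.1 * x.2) + s2 ^+ 2 * x.2 ^+ 2.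
Proof.
by rewrite /dot /mulmxv; have [-> -> -> ->] := covmxE s1 s2 r => /=; ring.
Qed.

Lemma normr_lt1 r : `|r| < 1 -> 0 < 1 - r ^+ 2.
Proof.
by move=> r1; rewrite subr_gt0 -(real_normK (num_real r)) exprn_ilt1.
Qed.

Lemma dot_covmx_gt0 (s1 s2 : R) r x : 0 < s1 -> 0 < s2 -> `|r| < 1 -> x != 0 ->
  0 < dot x (mulmxv (covmx s1 s2 r) x).
Proof.
move=> s10 s20 /normr_lt1 r1 x0; rewrite dot_covmx.
have -> : s1 ^+ 2 * x.1 ^+ 2 + 2 * (r * s1 * s2) * (x.1 * x.2) +
    s2 ^+ 2 * x.2 ^+ 2 =
    (s1 * x.1 + r * s2 * x.2) ^+ 2 + (1 - r ^+ 2) * (s2 * x.2) ^+ 2 by ring.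
have [x2|x2] := eqVneq x.2 0.
  rewrite x2 !mulr0 expr0n mulr0 !addr0 exprn_even_gt0//=.
  rewrite mulf_neq0 ?(gt_eqF s10)//.
  by apply: contra_neq x0 => x1; rewrite [x]surjective_pairing x1 x2.
rewrite ltr_wpDl ?sqr_ge0// mulr_gt0// exprn_even_gt0//=.
by rewrite mulf_neq0// gt_eqF.
Qed.

(* For a 2x2 matrix, Cayley-Hamilton gives
   [sqrt M = (M + sqrt (det M)) / sqrt (tr M + 2 sqrt (det M))]. *)
Lemma sqrtmx_covmx (s1 s2 : R) r : 0 < s1 -> 0 < s2 -> `|r| < 1 ->
  let S := sqrtmx (covmx s1 s2 r) in
  S^T = S /\ S *m S = covmx s1 s2 r.
Proof.
move=> s10 s20 r1 /=; rewrite /sqrtmx.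
(* Either the chosen matrix is a root, or there is none; the second case is refuted by the explicit
   root, with [D = sqrt (det M)] and [w = sqrt (tr M + 2 D)]. *)
case: xgetP => [S _ [[ST _] SS]//|/(_ _) H]; exfalso.
have r2 := normr_lt1 r1.
set q := Num.sqrt (1 - r ^+ 2).
have qE : q ^+ 2 = 1 - r ^+ 2 by rewrite sqr_sqrtr// ltW.
have q0 : 0 <= q by exact: sqrtr_ge0.
set D := s1 * s2 * q.
have D0 : 0 <= D by rewrite !mulr_ge0// ltW.
set w := Num.sqrt (s1 ^+ 2 + s2 ^+ 2 + 2 * D).
have w2 : 0 < s1 ^+ 2 + s2 ^+ 2 + 2 * D.
  by rewrite ltr_wpDr ?(mulr_ge0 _ D0)// addr_gt0// exprn_gt0.
have wE : w ^+ 2 = s1 ^+ 2 + s2 ^+ 2 + 2 * D by rewrite sqr_sqrtr// ltW.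
have w0 : 0 < w by rewrite sqrtr_gt0.
have [M00 M01 M10 M11] := covmxE s1 s2 r.
set N := covmx s1 s2 r + D%:M.
have N00 : N 0 0 = s1 ^+ 2 + D by rewrite mxE M00 mxE /= mulr1n.
have N01 : N 0 1 = r * s1 * s2 by rewrite mxE M01 mxE /= mulr0n addr0.
have N10 : N 1 0 = r * s1 * s2 by rewrite mxE M10 mxE /= mulr0n addr0.
have N11 : N 1 1 = s2 ^+ 2 + D by rewrite mxE M11 mxE /= mulr1n.
apply: (H (w^-1 *: N)); split; last first.
  have wi : w^-1 * w^-1 * (s1 ^+ 2 + s2 ^+ 2 + 2 * D) = 1.
    by rewrite -wE; field; rewrite gt_eqF.
  have DE : D * D = s1 ^+ 2 * s2 ^+ 2 - (r * s1 * s2) ^+ 2.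
    by rewrite -expr2 /D exprMn qE; ring.
  rewrite -scalemxAl -scalemxAr scalerA.
  apply: mx2P; rewrite [LHS]mxE mulmx2E ?N00 ?N01 ?N10 ?N11 ?M00 ?M01 ?M10 ?M11;
    rewrite -[RHS]mul1r -wi -[RHS]mulrA; congr (_ * _).
  - by rewrite mulrDl !mulrDr DE; ring.
  - by ring.
  - by ring.
  - by rewrite mulrDl !mulrDr DE; ring.
split.
  have NT : N^T = N by apply: mx2P; rewrite mxE ?N01 ?N10.
  by rewrite linearZ /= NT.
move=> x.
have -> : mulmxv (w^-1 *: N) x =
    w^-1 *: (mulmxv (covmx s1 s2 r) x + D *: x).
  rewrite /mulmxv; congr pair; rewrite !mxE /= ?mulr1n ?mulr0n;
    rewrite /= /GRing.scale /=; ring.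
rewrite dotZr dotDr dotZr mulr_ge0 ?invr_ge0 ?(ltW w0)//.
rewrite addr_ge0 ?(mulr_ge0 D0) ?dotxx_ge0//.
have [->|x0] := eqVneq x 0; first by rewrite /dot /= !mul0r addr0.
exact/ltW/dot_covmx_gt0.
Qed.

(** The larger root of the characteristic polynomial, with the discriminant arranged so that
    monotonicity in [r ^+ 2] is visible. *)
Definition top_eigenvalue (s1 s2 : R) r : R :=
  (s1 ^+ 2 + s2 ^+ 2 +
    Num.sqrt ((s1 ^+ 2 - s2 ^+ 2) ^+ 2 + 4 * r ^+ 2 * (s1 * s2) ^+ 2)) / 2.

(** These facts say that [l I - M], with [M] the covariance matrix, is positive semidefinite and
    singular: the first property gives the Rayleigh bound, the second an eigenvector. *)
Lemma top_eigenvalue_char (s1 s2 : R) r : let l := top_eigenvalue s1 s2 r in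
  [/\ 0 <= l - s1 ^+ 2, 0 <= l - s2 ^+ 2 &
      (l - s1 ^+ 2) * (l - s2 ^+ 2) = (r * s1 * s2) ^+ 2].
Proof.
rewrite /top_eigenvalue /=; set D := _ + 4 * _ * _; set q := Num.sqrt D.
have E0 : 0 <= 4 * r ^+ 2 * (s1 * s2) ^+ 2.
  by apply: mulr_ge0; [apply: mulr_ge0 => //|]; exact: sqr_ge0.
have D0 : 0 <= D by apply: addr_ge0 => //; exact: sqr_ge0.
have q2 : q ^+ 2 = D by rewrite sqr_sqrtr.
have : `|s1 ^+ 2 - s2 ^+ 2| <= q.
  by rewrite -sqrtr_sqr ler_wsqrtr// /D lerDl.
rewrite ler_norml => /andP[qa qb]; split; [lra|lra|].
have -> : ((s1 ^+ 2 + s2 ^+ 2 + q) / 2 - s1 ^+ 2) *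
          ((s1 ^+ 2 + s2 ^+ 2 + q) / 2 - s2 ^+ 2) =
          (q ^+ 2 - (s1 ^+ 2 - s2 ^+ 2) ^+ 2) / 4 by field.
by rewrite q2 /D; field.
Qed.

Lemma top_eigenvalue_gt0 (s1 s2 : R) r : 0 < s1 -> 0 < top_eigenvalue s1 s2 r.
Proof.
move=> s10; have [+ _ _] := top_eigenvalue_char s1 s2 r.
by rewrite subr_ge0; apply: lt_le_trans; rewrite exprn_gt0.
Qed.

Lemma dot_covmx_le (s1 s2 : R) r x :
  dot x (mulmxv (covmx s1 s2 r) x) <= top_eigenvalue s1 s2 r * dot x x.
Proof.
rewrite dot_covmx /dot -subr_ge0.
have [] := top_eigenvalue_char s1 s2 r; set l := top_eigenvalue _ _ _.
set B := r * s1 * s2; set A := l - _; set C := l - _ => A0 C0 ACB.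
have -> : l * (x.1 * x.1 + x.2 * x.2) - (s1 ^+ 2 * x.1 ^+ 2 +
    2 * B * (x.1 * x.2) + s2 ^+ 2 * x.2 ^+ 2) =
    A * x.1 ^+ 2 - 2 * B * (x.1 * x.2) + C * x.2 ^+ 2 by rewrite /A /C; ring.
have [A00|An0] := eqVneq A 0.
  move: ACB; rewrite A00 mul0r => /esym/eqP; rewrite sqrf_eq0 => /eqP ->.
  by rewrite mulr0 !mul0r subr0 add0r mulr_ge0 ?sqr_ge0.
have Agt0 : 0 < A by rewrite lt_def An0.
(* As [A C = B^2], multiplying the form by [A] makes it a perfect square. *)
rewrite -(pmulr_rge0 _ Agt0).
have -> : A * (A * x.1 ^+ 2 - 2 * B * (x.1 * x.2) + C * x.2 ^+ 2) =
  (A * x.1 - B * x.2) ^+ 2 by ring: ACB.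
exact: sqr_ge0.
Qed.

(** [(B, A)] spans the kernel of [l I - M] unless [A = 0]; then [B = 0] too, and the first axis
    serves. *)
Lemma top_eigenvector (s1 s2 : R) r : exists e : R * R, enorm e = 1 /\
  dot e (mulmxv (covmx s1 s2 r) e) = top_eigenvalue s1 s2 r.
Proof.
suff [x x0 xq] : exists2 x : R * R, x != 0 &
    dot x (mulmxv (covmx s1 s2 r) x) = top_eigenvalue s1 s2 r * dot x x.
  have n0 : 0 < enorm x by rewrite enorm_gt0.
  exists ((enorm x)^-1 *: x); split.
    by rewrite enormZ ger0_norm ?invr_ge0 ?enorm_ge0// mulVf// gt_eqF.
  rewrite mulmxvZ dotZl dotZr xq -sqr_enorm.
  by field; rewrite gt_eqF.
have [] := top_eigenvalue_char s1 s2 r; set l := top_eigenvalue _ _ _.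
set B := r * s1 * s2; set A := l - _; set C := l - _ => A0 C0 ACB.
have [A00|An0] := eqVneq A 0.
  exists (1, 0); first by rewrite -pair_eqE /= negb_and oner_eq0.
  rewrite dot_covmx /dot /=.
  have -> : l = s1 ^+ 2 by apply/eqP; rewrite -subr_eq0; exact/eqP.
  by ring.
exists (B, A); first by rewrite -pair_eqE /= negb_and An0 orbT.
rewrite dot_covmx -/B /dot /=; apply/eqP; rewrite eq_sym -subr_eq0.
have -> : l * (B * B + A * A) - (s1 ^+ 2 * B ^+ 2 + 2 * B * (B * A) +
  s2 ^+ 2 * A ^+ 2) = A * (A * C - B ^+ 2) by rewrite /A /C; ring.
by rewrite ACB subrr mulr0.
Qed.

Lemma top_eigenvalue_lt (s1 s2 : R) r r' : 0 < s1 -> 0 < s2 -> `|r| < `|r'| ->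
  top_eigenvalue s1 s2 r < top_eigenvalue s1 s2 r'.
Proof.
move=> s10 s20 rr'; rewrite /top_eigenvalue ltr_pM2r ?invr_gt0// ltrD2l.
have rr2 : r ^+ 2 < r' ^+ 2.
  rewrite -(real_normK (num_real r)) -(real_normK (num_real r')).
  by rewrite ltrXn2r// normr_ge0.
have s0 : 0 < (s1 * s2) ^+ 2 by rewrite exprn_gt0// mulr_gt0.
rewrite ltr_sqrt.
  by rewrite ltrD2l ltr_pM2r// ltr_pM2l.
have r'0 : 0 < r' ^+ 2 by apply: le_lt_trans rr2; exact: sqr_ge0.
by rewrite ltr_wpDl ?sqr_ge0// mulr_gt0// mulr_gt0.
Qed.

End Covariance.

(** * Lebesgue integrals *)

Section Integration.
Context {R : realType}.
Local Notation lambda := (@lebesgue_measure R).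
Implicit Types (D : set R) (f : R -> \bar R).

Lemma measurable_affine (a c : R) :
  measurable_fun [set: R] (fun x : R => (a * x + c)%R : measurableTypeR R).
Proof.
by apply: measurable_funD => //; exact: measurable_funM.
Qed.

(** Both sides are measures in [A] that agree on half-open intervals, so uniqueness of Lebesgue
    measure applies. *)
Lemma lebesgue_measure_affine (a c : R) (A : set R) : 0 < a -> measurable A ->
  (lambda A = a%:E * lambda ((fun x => a * x + c)%R @^-1` A))%E.
Proof.
move=> a0 mA.
pose phi : measurableTypeR R -> measurableTypeR R := fun x => a * x + c.
have mphi : measurable_fun [set: measurableTypeR R] phi := measurable_affine a c.
pose k : {nonneg R} := NngNum (ltW a0).
pose p : {measure set (measurableTypeR R) -> \bar R} :=
  measure_function_pushforward__canonical__measure_function_Measure lambda mphi.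
apply: (@lebesgue_measure_unique _ (mscale k p)) => // _ [[x y]] _ <-.
rewrite /mscale /= /pushforward /=.
have preim : (phi @^-1` `]x, y]%classic) = `](x - c) / a, (y - c) / a]%classic.
  apply/seteqP; split => z /=; rewrite !in_itv /= /phi => /andP[h1 h2];
  apply/andP; split; move: h1 h2;
    by rewrite ?ltr_pdivrMr ?ler_pdivlMr// ?ltrBlDr ?lerBrDr [z * a]mulrC.
transitivity (a%:E * lambda `]((x - c) / a)%R, ((y - c) / a)%R]%classic)%E; last first.
  by congr (_ * lambda _)%E; exact: esym preim.
rewrite !lebesgue_measure_itv /= !lte_fin ltr_pM2r ?invr_gt0// ltrD2r.
case: ifPn => xy; last by rewrite mule0.
by rewrite -!EFinB -EFinM; congr EFin; field; rewrite gt_eqF.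
Qed.

Lemma ge0_integral_affine (a c : R) D f : 0 < a -> measurable D ->
  measurable_fun setT f -> (forall x, 0 <= f x)%E ->
  (\int[lambda]_(x in D) f x =
   a%:E * \int[lambda]_(x in (fun x => a * x + c)%R @^-1` D) f (a * x + c)%R)%E.
Proof.
move=> a0 mD mf f0.
pose phi : measurableTypeR R -> measurableTypeR R := fun x => a * x + c.
have mphi : measurable_fun [set: measurableTypeR R] phi := measurable_affine a c.
pose k : {nonneg R} := NngNum (ltW a0).
have mfD : measurable_fun D f by exact: measurable_funS mf.
transitivity (a%:E * \int[pushforward lambda phi]_(x in D) f x)%E; last first.
  congr (_ * _)%E.
  by rewrite (@ge0_integral_pushforward _ _ _ _ _ phi mphi lambda D f).
rewrite -[a%:E]/(k%:num%:E).
pose p : {measure set (measurableTypeR R) -> \bar R} :=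
  measure_function_pushforward__canonical__measure_function_Measure lambda mphi.
rewrite (_ : pushforward lambda phi = p) // -ge0_integral_mscale//.
apply: eq_measure_integral => // A mA _.
exact: lebesgue_measure_affine.
Qed.

Lemma ge0_integral_opp D f : measurable D ->
  measurable_fun setT f -> (forall x, 0 <= f x)%E ->
  (\int[lambda]_(x in D) f x = \int[lambda]_(x in -%R @^-1` D) f (- x)%R)%E.
Proof.
move=> mD mf f0.
have mN : measurable_fun [set: measurableTypeR R]
    (-%R : measurableTypeR R -> measurableTypeR R) by exact: oppr_measurable.
have mfD : measurable_fun D f by exact: measurable_funS mf.
transitivity (\int[pushforward lambda (-%R : measurableTypeR R ->
    measurableTypeR R)]_(x in D) f x)%E; last first.
  by rewrite (@ge0_integral_pushforward _ _ _ _ _ _ mN lambda D f).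
by apply: eq_measure_integral => // A mA _; exact/esym/lebesgue_measureN.
Qed.

Lemma integral_support d (T : measurableType d) (m : {measure set T -> \bar R})
    (D E : set T) (f : T -> \bar R) : D `<=` E ->
  (forall x, E x -> ~ D x -> f x = 0%E) ->
  (\int[m]_(x in E) f x = \int[m]_(x in D) f x)%E.
Proof.
move=> DE f0; rewrite integral_mkcond [RHS]integral_mkcond.
apply: eq_integral => x _; rewrite /patch.
case: ifPn => [/set_mem Ex|nEx]; case: ifPn => [/set_mem Dx|nDx] //.
  by rewrite f0//; move/negP: nDx; rewrite inE.
by exfalso; move/negP: nEx; apply; rewrite inE; exact: DE.
Qed.

(** Finiteness of the integral of [g] allows it to be cancelled, leaving a nonnegative [f - g] with
    zero integral. *)
Lemma integral_eq_dominated_ae D (f g : R -> R) : measurable D ->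
  measurable_fun setT f -> measurable_fun setT g ->
  (forall x, 0 <= g x) -> (forall x, g x <= f x) ->
  (\int[lambda]_(x in D) (g x)%:E)%E \is a fin_num ->
  (\int[lambda]_(x in D) (f x)%:E = \int[lambda]_(x in D) (g x)%:E)%E ->
  exists M, [/\ measurable M, lambda M = 0%E &
    forall x, D x -> ~ M x -> f x = g x].
Proof.
move=> mD mf mg g0 gf gfin fg.
have mfg : measurable_fun D (fun x => (f x - g x)%:E).
  apply/measurable_EFinP; apply: (measurable_funS measurableT (@subsetT _ _)).
  exact: measurable_funB.
have split_f : (\int[lambda]_(x in D) (f x)%:E = \int[lambda]_(x in D) (g x)%:E +
    \int[lambda]_(x in D) (f x - g x)%:E)%E.
  rewrite -ge0_integralD//.
  - by apply: eq_integral => x _; rewrite -EFinD addrC subrK.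
  - by move=> x _; rewrite lee_fin.
  - apply/measurable_EFinP; exact: (measurable_funS measurableT (@subsetT _ _)).
  - by move=> x _; rewrite lee_fin subr_ge0.
have I0 : (\int[lambda]_(x in D) (f x - g x)%:E = 0)%E.
  move: split_f; rewrite fg -(fineK gfin).
  case: (\int[lambda]_(x in D) (f x - g x)%:E)%E => [u [] /eqP||] //.
  by rewrite addrC -subr_eq subrr eq_sym => /eqP ->.
have [+ _] := ae_eq_integral_abs lambda mD mfg.
case=> [|M [mM M0 sM]].
  by rewrite -[RHS]I0; apply: eq_integral => x _; rewrite /= ger0_norm ?subr_ge0.
exists M; split => // x Dx nM; apply: contrapT => fx; apply: nM; apply: sM => /=.
by move=> /(_ Dx) [] /eqP; rewrite subr_eq0 => /eqP.
Qed.

(** After a translation the domain is [[- phi - c, phi - c]]; the negative half is folded onto the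
    positive one, where [h t + h (- t) = 1 + k t]. The [1] contributes the length [phi + c], and the
    vanishing of [h] and [k] beyond [phi - |c|] makes the upper limits immaterial. *)
Lemma shock_integral (phi c : R) (h k : R -> R) : `|c| <= phi ->
  measurable_fun setT h -> measurable_fun setT k ->
  (forall t : R, 0 <= h t) -> (forall t : R, 0 <= k t) ->
  (forall t : R, 0 < t -> h t + h (- t) = 1 + k t) ->
  (forall t : R, phi - `|c| < t -> h t = 0 /\ k t = 0) ->
  (\int[lambda]_(x in `[(- phi)%R, phi]) (h (x - c)%R)%:E =
   (phi + c)%R%:E + \int[lambda]_(t in `]0%R, +oo[) (k t)%:E)%E.
Proof.
move=> cphi mh mk h0 k0 hk hk0.
have /andP[c1 c2] : - phi <= c <= phi by rewrite -ler_norml.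
have mhE : measurable_fun setT (EFin \o h) by exact/measurable_EFinP.
have mkE : measurable_fun setT (EFin \o k) by exact/measurable_EFinP.
have mhNE : measurable_fun setT (fun t : R => (h (- t)%R)%:E).
  rewrite -[X in measurable_fun _ X]/((EFin \o h) \o -%R).
  by apply: measurableT_comp => //; exact: oppr_measurable.
have hE0 x : (0 <= (h x)%:E)%E by rewrite lee_fin.
have nc := ler_norm c; have nc' := ler_norm (- c); rewrite normrN in nc'.
transitivity (\int[lambda]_(x in `[(- phi - c)%R, (phi - c)%R]) (h x)%:E)%E.
  rewrite [RHS](@ge0_integral_affine 1 (- c))// mul1e.
  have -> : ((fun x => 1 * x - c) @^-1` `[- phi - c, phi - c]%classic) =
      `[- phi, phi]%classic.
    by apply/seteqP; split => z /=; rewrite !in_itv /= mul1r !lerD2r.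
  by apply: eq_integral => x _; rewrite mul1r.
have -> : `[- phi - c, phi - c]%classic =
    `[- phi - c, 0]%classic `|` `]0, phi - c]%classic.
  rewrite -itv_bndbnd_setU// bnd_simp; lra.
rewrite ge0_integral_setU//; first last.
- apply/disj_setPS => z /= []; rewrite !in_itv /= => /andP[_ z1] /andP[z2 _].
  by move: z1; rewrite leNgt z2.
- exact: measurable_funS mhE.
(* Both [phi - c] and [phi + c] are at least [phi - |c|], so the limit can be changed to match that
   of the folded half. *)
have -> : (\int[lambda]_(x in `]0%R, (phi - c)%R]) (h x)%:E =
    \int[lambda]_(x in `]0%R, (phi + c)%R]) (h x)%:E)%E.
  transitivity (\int[lambda]_(x in `]0%R, +oo[) (h x)%:E)%E.
    apply/esym/integral_support => [z /=|z /=].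
      by rewrite !in_itv /= andbT => /andP[].
    rewrite !in_itv /= andbT => z0 /negP; rewrite z0 /= -ltNge => z1.
    by rewrite (hk0 z _).1//; lra.
  apply: integral_support => [z /=|z /=].
    by rewrite !in_itv /= andbT => /andP[].
  rewrite !in_itv /= andbT => z0 /negP; rewrite z0 /= -ltNge => z1.
  by rewrite (hk0 z _).1//; lra.
have -> : (\int[lambda]_(x in `[(- phi - c)%R, 0%R]) (h x)%:E =
    \int[lambda]_(x in `[0%R, (phi + c)%R]) (h (- x)%R)%:E)%E.
  rewrite (ge0_integral_opp (f := EFin \o h))//.
  congr (integral _ _ _); apply/seteqP; split => z /=; rewrite !in_itv /=;
    by move=> /andP[? ?]; apply/andP; split; lra.
(* The point [0] is dropped because [hk] holds only for [t > 0]; for identical platforms the sum at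
   [0] would be [2]. *)
rewrite -(@integral_itv_obnd_cbnd _ 0); last exact: measurable_funS mhNE.
rewrite -ge0_integralD//; last 2 first.
- exact: measurable_funS mhNE.
- exact: measurable_funS mhE.
have -> : (\int[lambda]_(t in `]0%R, +oo[) (k t)%:E =
    \int[lambda]_(t in `]0%R, (phi + c)%R]) (k t)%:E)%E.
  apply: integral_support => [z /=|z /=].
    by rewrite !in_itv /= andbT => /andP[].
  rewrite !in_itv /= andbT => z0 /negP; rewrite z0 /= -ltNge => z1.
  by rewrite (hk0 z _).2//; lra.
transitivity (\int[lambda]_(t in `]0%R, (phi + c)%R]) (1%:E + (k t)%:E))%E.
  apply: eq_integral => t /set_mem /=; rewrite in_itv /= => /andP[t0 _].
  by rewrite -!EFinD addrC hk.
rewrite ge0_integralD//; last 2 first.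
- by move=> x _; rewrite lee_fin.
- exact: measurable_funS mkE.
congr (_ + _)%E; rewrite integral_cst// mul1e /= lebesgue_measure_itv /= lte_fin.
rewrite oppr0 adde0; case: ifPn => //; rewrite -leNgt => ?.
by congr EFin; lra.
Qed.

End Integration.

(** * Supports of laws *)

Section Support.
Context {R : realType}.

(** Second countability, indexed by a [countType] so that unions over the basis become sequences
    through [pickle]. *)
Definition countable_open_basis {V : topologicalType} (I : countType)
    (B : I -> set V) : Prop :=
  (forall i, open (B i)) /\
  forall O x, open O -> O x -> exists2 i, B i x & B i `<=` O.

Definition rat_itv (q : rat * rat) : set R :=
  `]ratr q.1, ratr q.2[%classic.

Lemma rat_itv_basis : countable_open_basis rat_itv.
Proof.
split=> [i|O x oO Ox]; first exact: interval_open.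
have /nbhs_ballP[e /= e0 eO] : nbhs x O by exact: open_nbhs_nbhs.
have xe1 : x - e < x by rewrite gtrBl.
have xe2 : x < x + e by rewrite ltrDl.
have [q1 q1P] := rat_in_itvoo xe1; have [q2 q2P] := rat_in_itvoo xe2.
move: q1P q2P; rewrite !in_itv /= => /andP[a1 a2] /andP[b1 b2].
exists (q1, q2); rewrite /rat_itv /=; first by rewrite in_itv /= a2 b1.
move=> y; rewrite /= in_itv /= => /andP[y1 y2]; apply: eO.
by rewrite /ball /= ltr_norml; apply/andP; split; lra.
Qed.

Lemma rat_box_basis :
  countable_open_basis (fun q => rat_itv q.1 `*` rat_itv q.2).
Proof.
have [oB nB] := rat_itv_basis; split=> [i|O [x y] oO Oxy].
  rewrite openE => -[x y] [/= ix iy].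
  exists (rat_itv i.1, rat_itv i.2) => //=.
  by split; apply: open_nbhs_nbhs.
have [[A1 A2] /= [A1x A2y] AO] : nbhs (x, y) O by exact: open_nbhs_nbhs.
have [i ix iA] := nB _ _ (open_interior A1) (nbhs_singleton (nbhs_interior A1x)).
have [j jy jA] := nB _ _ (open_interior A2) (nbhs_singleton (nbhs_interior A2y)).
exists (i, j) => //= -[u v] [/= iu jv]; apply: AO; split => /=.
  by apply: interior_subset; apply: iA.
by apply: interior_subset; apply: jA.
Qed.

Context {d : measure_display} {T : measurableType d}.
Variable P : probability T R.

Lemma basis_measurable_preimage (V : topologicalType) (I : countType)
    (B : I -> set V) (f : T -> V) : countable_open_basis B ->
  (forall i, measurable (f @^-1` B i)) ->
  forall O, open O -> measurable (f @^-1` O).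
Proof.
move=> [oB nB] mB O oO.
have -> : f @^-1` O = \bigcup_n
    (if unpickle n is Some i then
       if `[< B i `<=` O >] then f @^-1` B i else set0 else set0).
  apply/seteqP; split => [t /= Ot|t [n _]].
    have [i Bi BO] := nB _ _ oO Ot; exists (pickle i) => //.
    by rewrite pickleK; case: asboolP.
  by case: unpickle => // i; case: asboolP => // BO /BO.
apply: bigcupT_measurable => n; case: unpickle => // i.
by case: asboolP => _.
Qed.

(** Outside the support, a point lies in one of the countably many basis sets of zero mass. [m] is a
    bare set function tied to [P] on open sets, which suits both the electorate and its
    projections. *)
Lemma law_support_full (V : topologicalType) (I : countType)
    (B : I -> set V) (f : T -> V) (m : set V -> \bar R) :
  countable_open_basis B -> (forall i, measurable (f @^-1` B i)) ->
  (forall O, open O -> m O = P (f @^-1` O)) ->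
  exists N, [/\ measurable N, P N = 0%E & forall t, ~ N t -> law_support m (f t)].
Proof.
move=> hB mB mE; have [oB nB] := hB.
have mO := basis_measurable_preimage hB mB.
pose F n := if unpickle n is Some i then
  if P (f @^-1` B i) == 0%E then f @^-1` B i else set0 else set0.
have mF n : measurable (F n).
  by rewrite /F; case: unpickle => // i; case: ifP.
have PF n : P (F n) = 0%E.
  by rewrite /F; case: unpickle => [i|]; rewrite ?measure0//;
    case: ifPn => [/eqP //|_]; rewrite measure0.
exists (\bigcup_n F n); split.
- exact: bigcupT_measurable.
- apply/negligibleP; first exact: bigcupT_measurable.
  by apply: negligible_bigcup => n; apply/negligibleP => //; exact: PF.
move=> t nFt O oO Ot; rewrite mE// lt0e measure_ge0 andbT.
apply/negP => /eqP PO; apply: nFt.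
have [i Bi BO] := nB _ _ oO Ot; exists (pickle i) => //.
rewrite /F pickleK; case: ifPn => // /negP; apply; apply/eqP/eqP.
rewrite -measure_le0 -PO; apply: le_measure; rewrite ?inE; [|exact: mO|].
  exact: mB.
by move=> u /BO.
Qed.

End Support.

(** * Utility and upper tail probabilities *)

Section Utility.
Context {R : realType}.
Variables (rho U : R -> R).
Hypotheses (rhoP : power_rule rho) (UP : utility_on (rho 0) (rho 1) U).

Let rho_itv s : s \in `[0, 1] -> rho s \in `[rho 0, rho 1].
Proof.
have [mono _ _ _] := rhoP.
have i0 : (0 : R) \in `[0, 1] by rewrite in_itv /= lexx ler01.
have i1 : (1 : R) \in `[0, 1] by rewrite in_itv /= lexx ler01.
move=> si; move: (si); rewrite !in_itv /= => /andP[s0 s1]; apply/andP; split.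
  by move: s0; rewrite le_eqVlt => /predU1P[<-//|s0]; exact/ltW/mono.
by move: s1; rewrite le_eqVlt => /predU1P[->//|s1]; exact/ltW/mono.
Qed.

Lemma utility_rule_mono : {in `[0, 1] &, {homo U \o rho : s t / s < t}}.
Proof.
have [mono _ _ _] := rhoP; have [_ Umono _] := UP.
by move=> s t si ti st /=; apply: Umono; [exact: rho_itv..|exact: mono].
Qed.

(** The symmetry of [rho] makes [rho p] and [rho (1 - p)] mirror convex combinations of [rho 0] and
    [rho 1], with weights [t] and [1 - t] exchanged; the two strict concavity inequalities are
    added. *)
Lemma utility_rule_concave (p : R) : 0 < p < 1 ->
  (U \o rho) 0 + (U \o rho) 1 < (U \o rho) p + (U \o rho) (1 - p).
Proof.
move=> /andP[p0 p1] /=; have [mono [rb rbP] _ _] := rhoP.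
have [_ _ conc] := UP.
have i0 : (0 : R) \in `[0, 1] by rewrite in_itv /= lexx ler01.
have i1 : (1 : R) \in `[0, 1] by rewrite in_itv /= lexx ler01.
have ip : p \in `[0, 1] by rewrite in_itv /= !ltW.
have h0 := mono _ _ i0 ip p0; have h1 := mono _ _ ip i1 p1.
have := rbP _ ip; rewrite -(rbP 0 i0) subr0 => sumE.
pose D := rho 1 - rho 0; pose t := (rho 1 - rho p) / D.
have D0 : 0 < D by rewrite subr_gt0 (lt_trans h0).
have t01 : 0 < t < 1.
  by rewrite /t ltr_pdivrMr// ltr_pdivlMr// mul0r mul1r /D; lra.
have t01' : 0 < 1 - t < 1 by move: t01 => /andP[? ?]; apply/andP; split; lra.
have r0 : rho 0 \in `[rho 0, rho 1] by exact: rho_itv.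
have r1 : rho 1 \in `[rho 0, rho 1] by exact: rho_itv.
have r01 : rho 0 != rho 1 by rewrite lt_eqF// (lt_trans h0).
have := conc _ _ _ r0 r1 r01 t01; have := conc _ _ _ r0 r1 r01 t01'.
have tD : t * D = rho 1 - rho p by rewrite divfK ?gt_eqF.
have -> : t * rho 0 + (1 - t) * rho 1 = rho p.
  by move: tD; rewrite /D; lra.
have -> : (1 - t) * rho 0 + (1 - (1 - t)) * rho 1 = rho (1 - p).
  by move: tD; rewrite /D; lra.
by lra.
Qed.

End Utility.

Section ComplementaryCdf.
Context {R : realType} {d : measure_display} {T : measurableType d}.
Variable P : probability T R.
Implicit Types W : T -> R.

(** The weak inequality matches [share_A]: a voter exactly at the shock supports [A]. *)
Definition upper_prob W (x : R) : R := fine (P [set t | x <= W t]).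

Lemma measurable_ge W x : measurable_fun setT W ->
  measurable [set t | x <= W t].
Proof.
move=> mW; rewrite -[X in measurable X]setTI.
have -> : [set t | x <= W t] = W @^-1` `[x, +oo[%classic.
  by apply/seteqP; split => t /=; rewrite in_itv /= andbT.
by apply: mW.
Qed.

Lemma measurable_gt W x : measurable_fun setT W ->
  measurable [set t | x < W t].
Proof.
move=> mW; rewrite -[X in measurable X]setTI.
have -> : [set t | x < W t] = W @^-1` `]x, +oo[%classic.
  by apply/seteqP; split => t /=; rewrite in_itv /= andbT.
by apply: mW.
Qed.

Lemma measurable_lt W x : measurable_fun setT W ->
  measurable [set t | W t < x].
Proof.
move=> mW; rewrite -[X in measurable X]setTI.
have -> : [set t | W t < x] = W @^-1` `]-oo, x[%classic.
  by apply/seteqP; split => t /=; rewrite in_itv /=.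
by apply: mW.
Qed.

Lemma measurable_eq W x : measurable_fun setT W ->
  measurable [set t | W t = x].
Proof.
move=> mW; rewrite -[X in measurable X]setTI.
have -> : [set t | W t = x] = W @^-1` [set x] by [].
by apply: mW.
Qed.

Lemma fine_prob (A : set T) : measurable A -> (fine (P A))%:E = P A.
Proof. by move=> mA; rewrite fineK// fin_num_measure. Qed.

Lemma fine_prob01 (A : set T) : measurable A -> 0 <= fine (P A) <= 1.
Proof.
by move=> mA; rewrite -!lee_fin fine_prob// measure_ge0 probability_le1.
Qed.

Lemma fine_probC (A : set T) : measurable A ->
  fine (P (~` A)) = 1 - fine (P A).
Proof.
move=> mA; rewrite probability_setC// -(fine_prob mA) -EFinB //.
Qed.

Lemma fine_prob_ae_le (N A B : set T) : measurable N -> P N = 0%E ->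
  measurable A -> measurable B -> A `<=` B `|` N ->
  fine (P A) <= fine (P B).
Proof.
move=> mN N0 mA mB AB; rewrite -lee_fin !fine_prob//.
apply: (@le_trans _ _ (P (B `|` N))).
  by apply: le_measure => //; rewrite inE//; exact: measurableU.
by rewrite -(adde0 (P B)) -N0; exact: measureU2.
Qed.

(** Yields a sample point of [A] at which almost sure bounds may be applied. *)
Lemma prob_gt0_point (N A : set T) : measurable N -> P N = 0%E ->
  measurable A -> fine (P A) != 0 -> exists2 t, A t & ~ N t.
Proof.
move=> mN N0 mA A0; apply: contrapT => H; move/eqP: A0; apply.
apply/eqP; rewrite eq_le; have /andP[-> _] := fine_prob01 mA; rewrite andbT.
have <- : fine (P set0) = 0 by rewrite measure0.
apply: (fine_prob_ae_le mN N0) => // t At; right; apply: contrapT => nN.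
by apply: H; exists t.
Qed.

Lemma upper_prob01 W x : measurable_fun setT W -> 0 <= upper_prob W x <= 1.
Proof. by move=> mW; exact/fine_prob01/measurable_ge. Qed.

Lemma upper_prob_ae_le (N : set T) W W' x y : measurable N -> P N = 0%E ->
  measurable_fun setT W -> measurable_fun setT W' ->
  (forall t, ~ N t -> x <= W t -> y <= W' t) ->
  upper_prob W x <= upper_prob W' y.
Proof.
move=> mN N0 mW mW' WW'; apply: (fine_prob_ae_le mN N0); try exact: measurable_ge.
by move=> t /= xW; have [?|nN] := pselect (N t); [right|left; exact: WW'].
Qed.

Lemma upper_prob_nonincreasing W : measurable_fun setT W ->
  nonincreasing_fun (upper_prob W).
Proof.
move=> mW x y xy; apply: (@upper_prob_ae_le set0) => // t _.
exact: le_trans.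
Qed.

Lemma upper_prob_shift W (c x : R) :
  upper_prob (fun t => c + W t) x = upper_prob W (x - c).
Proof.
rewrite /upper_prob; congr (fine (P _)).
by apply/seteqP; split => t /=; rewrite lerBlDl.
Qed.

End ComplementaryCdf.

(** * Integration over the shock *)

Section ShockPayoff.
Context {R : realType} {d : measure_display} {T : measurableType d}.
Variable P : probability T R.
Local Notation lambda := (@lebesgue_measure R).
Variables (n : R -> R) (phi : R).
Hypotheses (phi_gt0 : 0 < phi) (n0 : n 0 = 0) (n1 : n 1 = 1).
Hypothesis n_mono : {in `[0, 1] &, {homo n : s t / s < t}}.
Hypothesis n_concave : forall p, 0 < p < 1 -> 1 < n p + n (1 - p).
Implicit Types W : T -> R.

Let i0 : (0 : R) \in `[0, 1]. Proof. by rewrite in_itv /= lexx ler01. Qed.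
Let i1 : (1 : R) \in `[0, 1]. Proof. by rewrite in_itv /= lexx ler01. Qed.

Let n_le : {in `[0, 1] &, {homo n : s t / s <= t}}.
Proof.
move=> s t si ti; rewrite le_eqVlt => /predU1P[->//|st].
exact/ltW/n_mono.
Qed.

Let n_ge0 p : 0 <= p <= 1 -> 0 <= n p.
Proof. by move=> /andP[p0 p1]; rewrite -n0 n_le// in_itv /= p0. Qed.

Let n_le1 p : 0 <= p <= 1 -> n p <= 1.
Proof. by move=> /andP[p0 p1]; rewrite -n1 n_le// in_itv /= p0. Qed.

Let onem_itv (p : R) : 0 <= p <= 1 -> 0 <= 1 - p <= 1.
Proof. by move=> /andP[? ?]; apply/andP; split; lra. Qed.

(** Joint payoff of the parties in excess of [n 0 + n 1], the joint payoff at a unanimous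
    outcome. *)
Definition surplus (p : R) : R := n p + n (1 - p) - 1.

Let surplus0 : surplus 0 = 0.
Proof. by rewrite /surplus n0 subr0 n1; ring. Qed.

Lemma surplus_ge0 p : 0 <= p <= 1 -> 0 <= surplus p.
Proof.
move=> /andP[]; rewrite le_eqVlt => /predU1P[<- _|p0]; first by rewrite surplus0.
rewrite le_eqVlt => /predU1P[->|p1].
  by rewrite /surplus n1 subrr n0 addr0 subrr.
by rewrite /surplus subr_ge0 ltW// n_concave// p0.
Qed.

Lemma surplus_le1 p : 0 <= p <= 1 -> surplus p <= 1.
Proof.
by move=> pi; have := n_le1 pi; have := n_le1 (onem_itv pi); rewrite /surplus; lra.
Qed.

Lemma win_nonincreasing W : measurable_fun setT W ->
  nonincreasing_fun (n \o upper_prob P W).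
Proof.
move=> mW x y xy /=; apply: n_le; rewrite ?in_itv /=; try exact: upper_prob01.
exact: upper_prob_nonincreasing.
Qed.

(** Monotonicity is the source of measurability, as [n] may jump. *)
Lemma measurable_win W : measurable_fun setT W ->
  measurable_fun setT (n \o upper_prob P W).
Proof.
by move=> mW; apply: nonincreasing_measurable => //; exact: win_nonincreasing.
Qed.

Lemma win_ge0 W x : measurable_fun setT W -> 0 <= n (upper_prob P W x).
Proof. by move=> mW; apply: n_ge0; exact: upper_prob01. Qed.

Lemma win_le1 W x : measurable_fun setT W -> n (upper_prob P W x) <= 1.
Proof. by move=> mW; apply: n_le1; exact: upper_prob01. Qed.

Lemma measurable_surplus W : measurable_fun setT W ->
  measurable_fun setT (fun y => surplus (upper_prob P W y)).
Proof.
move=> mW; apply: measurable_funB => //; apply: measurable_funD.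
  exact: measurable_win.
apply: nondecreasing_measurable => // x y xy; apply: n_le; rewrite ?in_itv /=;
  try by apply: onem_itv; exact: upper_prob01.
by rewrite lerD2l lerN2; exact: upper_prob_nonincreasing.
Qed.

(** The expected normalized payoff times [2 * phi], the length of the shock interval. *)
Definition shock_value W : \bar R :=
  (\int[lambda]_(x in `[(- phi)%R, phi]) (n (upper_prob P W x))%:E)%E.

(** For [W = Y] this is the constant [k]. *)
Definition total_surplus W : \bar R :=
  (\int[lambda]_(y in `]0%R, +oo[) (surplus (upper_prob P W y))%:E)%E.

Lemma shock_value_le (N : set T) W W' : measurable N -> P N = 0%E ->
  measurable_fun setT W -> measurable_fun setT W' ->
  (forall t, ~ N t -> W t <= W' t) -> (shock_value W <= shock_value W')%E.
Proof.
move=> mN N0 mW mW' WW'; apply: ge0_le_integral => //.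
- by move=> x _; rewrite lee_fin win_ge0.
- by apply/measurable_EFinP; apply: measurable_funS (measurable_win mW).
- by apply/measurable_EFinP; apply: measurable_funS (measurable_win mW').
move=> x _; rewrite lee_fin n_le// ?in_itv /=; try exact: upper_prob01.
by apply: (upper_prob_ae_le mN N0) => // t /WW' h xW; exact: le_trans h.
Qed.

Lemma shock_value_fin W : measurable_fun setT W ->
  shock_value W \is a fin_num.
Proof.
move=> mW; rewrite ge0_fin_numE; last first.
  by apply: integral_ge0 => x _; rewrite lee_fin win_ge0.
apply: (@le_lt_trans _ _ (\int[lambda]_(x in `[(- phi)%R, phi]) cst 1%:E x)%E).
  apply: ge0_le_integral => //.
  - by move=> x _; rewrite lee_fin win_ge0.
  - by apply/measurable_EFinP; apply: measurable_funS (measurable_win mW).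
  - by move=> x _; rewrite lee_fin win_le1.
by rewrite integral_cst// mul1e /= lebesgue_measure_itv /=; case: ifP; rewrite ltry.
Qed.

Lemma shock_value_formula W (c : R) : measurable_fun setT W -> `|c| <= phi ->
  (forall t, 0 < t -> upper_prob P W t + upper_prob P W (- t) = 1) ->
  (forall t, phi - `|c| < t -> upper_prob P W t = 0) ->
  shock_value (fun t => c + W t) = ((phi + c)%:E + total_surplus W)%E.
Proof.
move=> mW cphi symW bW; rewrite /shock_value.
under eq_integral do rewrite upper_prob_shift.
apply: (@shock_integral _ phi c (n \o upper_prob P W)
  (fun y => surplus (upper_prob P W y))) => //.
- exact: measurable_win.
- exact: measurable_surplus.
- by move=> t; exact: win_ge0.
- by move=> t; apply: surplus_ge0; exact: upper_prob01.
- move=> t t0 /=; have -> : upper_prob P W (- t) = 1 - upper_prob P W t.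
    by rewrite -(symW _ t0); ring.
  by rewrite /surplus; ring.
- by move=> t /bW /= ->; rewrite n0 surplus0.
Qed.

(** A change of variable. [W'] is compared with [a * W] through tail probabilities only, so that
    equality in law of [dot v X] and [|S v| Y] suffices. *)
Lemma total_surplus_scale W W' (a : R) : 0 <= a -> measurable_fun setT W ->
  (forall y, upper_prob P W' y = upper_prob P (fun t => a * W t) y) ->
  total_surplus W' = (a%:E * total_surplus W)%E.
Proof.
move=> a0 mW WW'; rewrite /total_surplus.
have [a00|an0] := eqVneq a 0.
  rewrite a00 mul0e; apply: integral0_eq => y /=.
  rewrite in_itv /= andbT => y0; rewrite WW' a00 /upper_prob.
  have -> : [set t | y <= 0 * W t] = set0.
    by apply/seteqP; split => t //=; rewrite mul0r leNgt y0.
  by rewrite measure0 /= surplus0.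
have agt0 : 0 < a by rewrite lt_def an0.
have mk : measurable_fun setT (fun y => (surplus (upper_prob P W' y))%:E).
  apply/measurable_EFinP.
  rewrite (_ : (fun y => _) = fun y => surplus (upper_prob P (fun t => a * W t) y)).
    by apply: measurable_surplus; exact: measurable_funM.
  by apply/funext => y; rewrite WW'.
have k0 y : (0 <= (surplus (upper_prob P W' y))%:E)%E.
  rewrite lee_fin WW'; apply: surplus_ge0; apply: upper_prob01.
  exact: measurable_funM.
rewrite (ge0_integral_affine 0 agt0)//; congr (_ * _)%E.
have -> : (fun x : R => a * x + 0) @^-1` `]0%R, +oo[%classic = `]0%R, +oo[%classic.
  by apply/seteqP; split => y /=; rewrite !in_itv /= !andbT addr0 pmulr_rgt0.
apply: eq_integral => y _; rewrite WW' addr0 /upper_prob; congr (surplus (fine (P _)))%:E.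
by apply/seteqP; split => t /=; rewrite ler_pM2l.
Qed.

Lemma total_surplus_ge0 W : measurable_fun setT W -> (0 <= total_surplus W)%E.
Proof.
move=> mW; apply: integral_ge0 => x _; rewrite lee_fin.
by apply: surplus_ge0; exact: upper_prob01.
Qed.

(** The integrand is at most [1] and vanishes beyond [M]. This gives both finiteness of [k] and the
    bound that keeps equilibria in the disc. *)
Lemma total_surplus_le W (M : R) : measurable_fun setT W -> 0 <= M ->
  (forall y, M < y -> upper_prob P W y = 0) -> (total_surplus W <= M%:E)%E.
Proof.
move=> mW M0 WM; rewrite /total_surplus.
have mk : measurable_fun setT (fun y => (surplus (upper_prob P W y))%:E).
  by apply/measurable_EFinP; exact: measurable_surplus.
have -> : (\int[lambda]_(y in `]0%R, +oo[) (surplus (upper_prob P W y))%:E =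
    \int[lambda]_(y in `]0%R, M]) (surplus (upper_prob P W y))%:E)%E.
  apply: integral_support => y /=; rewrite !in_itv /= andbT; first by case/andP.
  by move=> -> /negP; rewrite -ltNge => /WM ->; rewrite surplus0.
apply: (@le_trans _ _ (\int[lambda]_(x in `]0%R, M]) cst 1%:E x)%E).
  apply: ge0_le_integral => //.
  - by move=> x _; rewrite lee_fin; apply: surplus_ge0; exact: upper_prob01.
  - exact: measurable_funS mk.
  - by move=> x _; rewrite lee_fin; apply: surplus_le1; exact: upper_prob01.
rewrite integral_cst// mul1e /= lebesgue_measure_itv /= lte_fin.
by case: ifP; rewrite ?oppr0 ?adde0 lee_fin.
Qed.

(** On []0, y0]] the tail probability lies strictly between [0] and [1], so the integrand is
    positive there; a zero integral would make this interval null. *)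
Lemma total_surplus_gt0 W (y0 : R) : measurable_fun setT W -> 0 < y0 ->
  0 < upper_prob P W y0 -> (forall y, 0 < y -> upper_prob P W y < 1) ->
  (0 < total_surplus W)%E.
Proof.
move=> mW y00 Wy0 W1; rewrite lt0e total_surplus_ge0// andbT.
have mk : measurable_fun setT (fun y => (surplus (upper_prob P W y))%:E).
  by apply/measurable_EFinP; exact: measurable_surplus.
apply/negP => /eqP K0.
have [] := (@ae_eq_integral_abs _ _ _ lambda `]0, +oo[%classic
  (measurable_itv _) (fun y => (surplus (upper_prob P W y))%:E)
  (measurable_funS measurableT (@subsetT _ _) mk)).
move=> + _; case.
  rewrite -[RHS]K0; apply: eq_integral => y _; rewrite /= ger0_norm//.
  by apply: surplus_ge0; exact: upper_prob01.
move=> N [mN N0 sN].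
have : (lambda `]0%R, y0]%classic <= lambda N)%E.
  apply: le_measure; rewrite ?inE//.
  move=> y /=; rewrite in_itv /= => /andP[yp yy0]; apply: sN => /= H.
  have := H; rewrite in_itv /= yp /= => /(_ isT) [] /eqP.
  rewrite gt_eqF// subr_gt0 n_concave// W1// andbT (lt_le_trans Wy0)//.
  exact: upper_prob_nonincreasing.
by rewrite [leRHS]N0 /= lebesgue_measure_itv /= lte_fin y00 oppr0 adde0 lee_fin leNgt y00.
Qed.

End ShockPayoff.

(** * The platform game *)

Section PlatformGame.
Context {R : realType} {d : measure_display} {T : measurableType d}.
Variable P : probability T R.
Local Notation lambda := (@lebesgue_measure R).
Variables (n : R -> R) (phi : R).
Hypotheses (phi_gt0 : 0 < phi) (n0 : n 0 = 0) (n1 : n 1 = 1).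
Hypothesis n_mono : {in `[0, 1] &, {homo n : s t / s < t}}.
Hypothesis n_concave : forall p, 0 < p < 1 -> 1 < n p + n (1 - p).
Variables (X : T -> R * R) (Y : T -> R) (S : 'M[R]_2) (r : R) (N : set T).
Hypothesis mX : forall v, measurable_fun setT (fun t => dot v (X t)).
Hypothesis mY : measurable_fun setT Y.
Hypotheses (mN : measurable N) (N0 : P N = 0%E).
Hypothesis X_le : forall t, ~ N t -> enorm (X t) <= r.
Hypotheses (r_ge0 : 0 <= r) (r_phi : 4 * r ^+ 2 < phi).
Hypothesis projection : forall v y, upper_prob P (fun t => dot v (X t)) y =
  upper_prob P (fun t => enorm (mulmxv S v) * Y t) y.
Hypothesis X_atomless : forall v y, v != 0 -> P [set t | dot v (X t) = y] = 0%E.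
Hypothesis Y_atomless : forall y, P [set t | Y t = y] = 0%E.
Hypothesis Y_sym : forall y, P [set t | Y t < - y] = P [set t | y < Y t].
Hypothesis X_gapless : forall v x y, v != 0 -> x < y ->
  upper_prob P (fun t => dot v (X t)) x = upper_prob P (fun t => dot v (X t)) y ->
  upper_prob P (fun t => dot v (X t)) x = 1 \/
  upper_prob P (fun t => dot v (X t)) y = 0.
Implicit Types (a b v : R * R).

Definition margin a b (t : T) : R :=
  dot (b - X t) (b - X t) - dot (a - X t) (a - X t).

(** The square of the bliss point cancels, so the margin is affine in a one-dimensional projection
    of [X]. *)
Lemma marginE a b : margin a b =
  fun t => (dot b b - dot a a) + dot (2 *: (a - b)) (X t).
Proof. by apply/funext => t; rewrite /margin /dot /= /GRing.scale /=; ring. Qed.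

Lemma measurable_margin a b : measurable_fun setT (margin a b).
Proof. by rewrite marginE; apply: measurable_funD => //; exact: mX. Qed.

Definition value a b : R := fine (shock_value P n phi (margin a b)).

Let valueE a b : (value a b)%:E = shock_value P n phi (margin a b).
Proof. by rewrite fineK// shock_value_fin//; exact: measurable_margin. Qed.

Lemma value_le a b a' b' :
  (forall t, ~ N t -> margin a b t <= margin a' b' t) ->
  value a b <= value a' b'.
Proof.
move=> H; rewrite -lee_fin !valueE; apply: (shock_value_le phi n0 n_mono mN N0) => //;
  exact: measurable_margin.
Qed.

Let dist_bound a x : enorm a <= r -> enorm x <= r ->
  0 <= dot (a - x) (a - x) <= 4 * r ^+ 2.
Proof.
move=> ar xr; rewrite dotxx_ge0 /= -sqr_enorm.
have h : enorm (a - x) <= 2 * r.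
  have := enormD a (- x); have -> : enorm (- x) = enorm x.
    by rewrite /enorm; congr Num.sqrt; rewrite /dot /=; ring.
  lra.
have -> : 4 * r ^+ 2 = (2 * r) ^+ 2 by ring.
by rewrite lerXn2r ?nnegrE ?enorm_ge0// mulr_ge0.
Qed.

Let scaledY_sym (s y : R) : 0 <= s -> 0 < y ->
  upper_prob P (fun t => s * Y t) y + upper_prob P (fun t => s * Y t) (- y) = 1.
Proof.
move=> s0 y0; rewrite /upper_prob.
have msY : measurable_fun setT (fun t => s * Y t) by exact: measurable_funM.
have -> : [set t | - y <= s * Y t] = ~` [set t | s * Y t < - y].
  by apply/seteqP; split => t /=; rewrite leNgt => /negP.
rewrite fine_probC; last exact: measurable_lt.
suff -> : fine (P [set t | s * Y t < - y]) = fine (P [set t | y <= s * Y t]) by ring.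
have [->|sn0] := eqVneq s 0.
  congr (fine (P _)); apply/seteqP; split => t /=; rewrite mul0r.
    by rewrite oppr_gt0 ltNge ltW.
  by rewrite leNgt y0.
have sgt0 : 0 < s by rewrite lt_def sn0.
have -> : [set t | s * Y t < - y] = [set t | Y t < - (y / s)].
  by apply/seteqP; split => t /=; rewrite -mulNr ltr_pdivlMr// mulrC.
rewrite Y_sym.
have mE : measurable [set t | Y t = y / s] by exact: measurable_eq.
apply/eqP; rewrite eq_le; apply/andP; split.
  apply: (@fine_prob_ae_le _ _ _ _ set0) => //; first exact: measurable_gt.
    exact: measurable_ge.
  by move=> t /= /ltW yY; left; move: yY; rewrite /= ler_pdivrMr// mulrC.
apply: (fine_prob_ae_le mE (Y_atomless _)); [exact: measurable_ge|exact: measurable_gt|].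
move=> t /=; rewrite mulrC -ler_pdivrMr// le_eqVlt => /predU1P[yY|]; last by left.
by right.
Qed.

Lemma value_interior a b : enorm a <= r -> enorm b <= r ->
  total_surplus P n Y \is a fin_num ->
  value a b = phi + quadratic_payoff S (fine (total_surplus P n Y)) a b.
Proof.
move=> ar br Kfin; apply: EFin_inj; rewrite valueE marginE.
set c := dot b b - dot a a; set v := 2 *: (a - b).
(* [c + dot v x] and [c - dot v x] are the margins of voters at [x] and [- x], each a difference of
   squared distances in [[0, 4 r^2]]. This is where the constant [4] is used. *)
have bound x : enorm x <= r -> `|c| + `|dot v x| <= 4 * r ^+ 2.
  move=> xr; have xr' : enorm (- x) <= r.
    by rewrite -[- x]add0r enormB subr0.
  have /andP[a1 a2] := dist_bound ar xr; have /andP[b1 b2] := dist_bound br xr.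
  have /andP[a3 a4] := dist_bound ar xr'; have /andP[b3 b4] := dist_bound br xr'.
  have E1 : c + dot v x = dot (b - x) (b - x) - dot (a - x) (a - x).
    by rewrite /c /v /dot /= /GRing.scale /=; ring.
  have E2 : c - dot v x = dot (b - - x) (b - - x) - dot (a - - x) (a - - x).
    by rewrite /c /v /dot /= /GRing.scale /=; ring.
  by case: (ger0P c) => c0; case: (ger0P (dot v x)) => x0; lra.
rewrite (@shock_value_formula _ _ _ _ _ _ n0 n1 n_mono n_concave).
- rewrite (@total_surplus_scale _ _ _ P n n0 n1 n_mono n_concave Y _
    (enorm (mulmxv S v)))//; last by exact: enorm_ge0.
  rewrite -{1}(fineK Kfin) -EFinM -EFinD /quadratic_payoff -/c; congr EFin.
  rewrite /v mulmxvZ enormZ ger0_norm//; ring.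
- exact: mX.
- apply: le_trans (ltW r_phi); apply: le_trans (bound 0 _).
    by rewrite lerDl.
  by rewrite enorm0.
- by move=> y y0; rewrite !projection; apply: scaledY_sym => //; exact: enorm_ge0.
move=> y yc; apply/eqP; rewrite eq_le.
have /andP[-> _] := upper_prob01 P y (mX v); rewrite andbT.
have <- : fine (P set0) = 0 by rewrite measure0.
apply: (fine_prob_ae_le mN N0) => //; first exact: measurable_ge.
move=> t /= yt; right; apply: contrapT => /X_le/bound.
have := ler_norm (dot v (X t)) => h xb.
have := lt_le_trans yc (le_trans yt h); rewrite ltrBlDl => h1.
by have := lt_trans (lt_le_trans h1 xb) r_phi; rewrite ltxx.
Qed.

(** The weak domination reduces deviations to the disc; the uniform gain [e] serves to exclude
    equilibria outside it. *)
Lemma value_project a : exists a', [/\ enorm a' <= r,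
  forall b, value a b <= value a' b &
  r < enorm a -> exists2 e, 0 < e &
    forall b t, ~ N t -> margin a b t + e <= margin a' b t].
Proof.
have [a' [a'r [e [e0 ea] H]]] := disc_projection a r_ge0.
exists a'; split => // [b|/ea egt0].
  apply: value_le => t /X_le/H; rewrite /margin; lra.
by exists e => // b t /X_le/H; rewrite /margin; lra.
Qed.

(** Identical platforms have zero margin wherever they stand, so both may be moved to the origin,
    where the formula in the disc applies. *)
Lemma value_diag b : total_surplus P n Y \is a fin_num -> value b b = phi.
Proof.
move=> Kfin; have -> : value b b = value 0 0.
  by rewrite /value; congr (fine (shock_value _ _ _ _)); apply/funext => t;
    rewrite /margin !subrr.
rewrite value_interior ?enorm0// /quadratic_payoff !subrr.
have -> : mulmxv S 0 = 0 by rewrite /mulmxv /= !mulr0 addr0.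
by rewrite enorm0 mulr0 !addr0.
Qed.

(** Identical platforms put all the mass at [0], hence the exception. *)
Lemma margin_atomless a b y : y != 0 -> P [set t | margin a b t = y] = 0%E.
Proof.
move=> y0; have [->|ab] := eqVneq a b.
  have -> : [set t | margin b b t = y] = set0; last by rewrite measure0.
  by apply/seteqP; split => t //=; rewrite /margin subrr => /esym/eqP; rewrite (negbTE y0).
rewrite marginE.
have -> : [set t | dot b b - dot a a + dot (2 *: (a - b)) (X t) = y] =
    [set t | dot (2 *: (a - b)) (X t) = y - (dot b b - dot a a)].
  by apply/seteqP; split => t /=; lra.
by apply: X_atomless; rewrite scaler_eq0 pnatr_eq0 /= subr_eq0.
Qed.

Lemma margin_gapless a b x y : x < y ->
  upper_prob P (margin a b) x = upper_prob P (margin a b) y ->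
  upper_prob P (margin a b) x = 1 \/ upper_prob P (margin a b) y = 0.
Proof.
move=> xy; have [->|ab] := eqVneq a b.
  move=> _; rewrite /upper_prob; have [x0|x0] := leP x 0; [left|right].
    have -> : [set t | x <= margin b b t] = setT.
      by apply/seteqP; split => t //= _; rewrite /margin subrr.
    by rewrite probability_setT.
  have -> : [set t | y <= margin b b t] = set0; last by rewrite measure0.
  apply/seteqP; split => t //=; rewrite /margin subrr; lra.
rewrite marginE !upper_prob_shift; apply: X_gapless; last by rewrite ltrD2r.
by rewrite scaler_eq0 pnatr_eq0 /= subr_eq0.
Qed.

(* The complementary share is the share of the swapped contest under the
   opposite shock; ties have zero mass except possibly at the shock [0]. *)
Lemma value_swap a b :
  (\int[lambda]_(x in `[(- phi)%R, phi])
     (n (1 - upper_prob P (margin a b) x)%R)%:E = (value b a)%:E)%E.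
Proof.
have mab := measurable_margin a b; have mba := measurable_margin b a.
have onem (p : R) : 0 <= p <= 1 -> 0 <= 1 - p <= 1.
  by move=> /andP[? ?]; apply/andP; split; lra.
have n_ge0 p : 0 <= p <= 1 -> 0 <= n p.
  move=> /andP[]; rewrite le_eqVlt => /predU1P[<-|p0 p1]; first by rewrite n0.
  by rewrite -n0 ltW// n_mono// in_itv /= ?lexx ?ler01// p1 ltW.
have mf : measurable_fun setT (fun x => n (1 - upper_prob P (margin a b) x)).
  apply: nondecreasing_measurable => // x y xy.
  have : 1 - upper_prob P (margin a b) x <= 1 - upper_prob P (margin a b) y.
    by rewrite lerD2l lerN2; exact: upper_prob_nonincreasing.
  rewrite le_eqVlt => /predU1P[->//|lt].
  by apply/ltW/n_mono => //; rewrite in_itv /=; apply: onem; exact: upper_prob01.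
rewrite valueE (ge0_integral_opp (f := fun x =>
  (n (1 - upper_prob P (margin a b) x))%:E))//; first last.
- by move=> x; rewrite lee_fin; apply: n_ge0; apply: onem; exact: upper_prob01.
- exact/measurable_EFinP.
have -> : (-%R @^-1` `[(- phi)%R, phi]%classic) = `[(- phi)%R, phi]%classic :> set R.
  by apply/seteqP; split => x /=; rewrite !in_itv /= => /andP[? ?];
    apply/andP; split; lra.
apply: ge0_ae_eq_integral => //.
- apply/measurable_EFinP.
  apply: (measurable_funS measurableT (@subsetT _ _)).
  rewrite -[X in measurable_fun _ X]/
    ((fun x => n (1 - upper_prob P (margin a b) x)) \o -%R).
  by apply: measurableT_comp => //; exact: oppr_measurable.
- apply/measurable_EFinP; apply: (measurable_funS measurableT (@subsetT _ _)).
  exact: measurable_win.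
- by move=> x _; rewrite lee_fin; apply: n_ge0; apply: onem; exact: upper_prob01.
- by move=> x _; rewrite lee_fin; apply: n_ge0; exact: upper_prob01.
exists [set 0]; split; [exact: measurable_set1|exact: lebesgue_measure_set1|].
move=> x /= H; apply: contrapT => /eqP x0; apply: H => _; congr (n _)%:E.
rewrite /upper_prob -fine_probC; last exact: measurable_ge.
have -> : ~` [set t | - x <= margin a b t] = [set t | x < margin b a t].
  by apply/seteqP; split => t /=; rewrite /margin => H;
    [move/negP: H; rewrite -ltNge|apply/negP; rewrite -ltNge]; lra.
have mE : measurable [set t | margin b a t = x] by exact: measurable_eq.
apply/eqP; rewrite eq_le; apply/andP; split.
  apply: (@fine_prob_ae_le _ _ _ _ set0) => //; first exact: measurable_gt.
    exact: measurable_ge.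
  by move=> t /= /ltW; left.
apply: (fine_prob_ae_le mE (margin_atomless _ _ x0));
  [exact: measurable_ge|exact: measurable_gt|].
by move=> t /=; rewrite le_eqVlt => /predU1P[->|]; [right|left].
Qed.

Lemma itv_conull_point (M : set R) (x y : R) : lambda M = 0%E ->
  measurable M -> x < y -> exists2 z, x < z < y & ~ M z.
Proof.
move=> M0 mM xy; apply: contrapT => H.
have : (lambda `]x, y[%classic <= lambda M)%E.
  apply: le_measure; rewrite ?inE// => z /=; rewrite in_itv /= => zi.
  by apply: contrapT => nM; apply: H; exists z.
by rewrite [leRHS]M0 /= lebesgue_measure_itv /= lte_fin xy -EFinB lee_fin leNgt subr_gt0 xy.
Qed.

(* If [a] lies outside the disc, moving it to the disc raises the margin of
   every voter by at least [e > 0]. In equilibrium this cannot help, so the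
   share is constant on almost every window [[x - e, x]] of shocks; by
   gaplessness it is then almost surely [0] or [1], hence constant. One party
   would then get its worst payoff, although imitation yields [phi]. *)
Lemma equilibrium_in_disc a b : total_surplus P n Y \is a fin_num ->
  (forall y, value y b <= value a b) -> (forall y, value y a <= value b a) ->
  enorm a <= r.
Proof.
move=> Kfin brA brB; rewrite leNgt; apply/negP => ra.
have [a' [_ _ /(_ ra) [e e0 ea]]] := value_project a.
have mab := measurable_margin a b.
have phia : phi <= value a b by rewrite -(value_diag b Kfin).
have phib : phi <= value b a by rewrite -(value_diag a Kfin).
set u := upper_prob P (margin a b).
have u01 x : 0 <= u x <= 1 by exact: upper_prob01.
have onem_u x : 0 <= 1 - u x <= 1.
  by have /andP[? ?] := u01 x; apply/andP; split; lra.
have u_mono : nonincreasing_fun u by exact: upper_prob_nonincreasing.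
have mshift : measurable_fun setT (fun t => e + margin a b t).
  exact: measurable_funD.
(* One inequality because the deviation to [a'] dominates the margin raised by [e] and does not pay;
   the other because a higher margin pays at least as much. *)
have shiftE : (\int[lambda]_(x in `[(- phi)%R, phi]) (n (u (x - e)%R))%:E =
    \int[lambda]_(x in `[(- phi)%R, phi]) (n (u x))%:E)%E.
  have -> : (\int[lambda]_(x in `[(- phi)%R, phi]) (n (u (x - e)%R))%:E =
      shock_value P n phi (fun t => e + margin a b t)%R)%E.
    by apply: eq_integral => x _; rewrite upper_prob_shift.
  apply/eqP; rewrite eq_le; apply/andP; split.
    rewrite -[leRHS]valueE; apply: (@le_trans _ _ (value a' b)%:E); last first.
      by rewrite lee_fin.
    rewrite valueE; apply: (shock_value_le phi n0 n_mono mN N0) => //.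
      exact: measurable_margin.
    by move=> t /(ea b); rewrite addrC.
  apply: (shock_value_le phi n0 n_mono mN N0) => // t _.
  by rewrite lerDr ltW.
have mu_e : measurable_fun setT (fun x : R => n (u (x - e))).
  rewrite (_ : (fun x => _) = n \o upper_prob P (fun t => e + margin a b t)).
    exact: measurable_win.
  by apply/funext => x /=; rewrite upper_prob_shift.
have u_e x : u x <= u (x - e) by apply: u_mono; rewrite gerBl ltW.
have [M [mM M0 Meq]] : exists M, [/\ measurable M, lambda M = 0%E &
    forall x, `[- phi, phi]%classic x -> ~ M x -> u (x - e) = u x].
  have [] := integral_eq_dominated_ae (measurable_itv _) mu_e
    (measurable_win P n_mono mab) _ _ _ shiftE.
  - by move=> x; exact: win_ge0.
  - move=> x /=; rewrite -/u; have := u_e x; rewrite le_eqVlt => /predU1P[->//|].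
    by move=> h; apply/ltW/n_mono => //; rewrite in_itv /=.
  - exact: shock_value_fin.
  (* Strict monotonicity of [n] turns equal payoffs into equal shares. *)
  move=> M [mM M0 H]; exists M; split => // x xi xM.
  have := u_e x; rewrite le_eqVlt => /predU1P[//|h].
  have /n_mono := h; rewrite !in_itv /= !u01 => /(_ isT isT).
  by rewrite H// ltxx.
have dich x : `[- phi, phi]%classic x -> ~ M x -> u x = 1 \/ u x = 0.
  move=> xi xM; have h := Meq _ xi xM.
  have xe : x - e < x by rewrite gtrBl.
  by have [] := margin_gapless xe h; [left; rewrite -h|right].
have ae0 (f : R -> R) : (forall x, `[- phi, phi]%classic x -> ~ M x -> f x = 0) ->
    measurable_fun setT f -> (forall x, 0 <= f x) ->
    (\int[lambda]_(x in `[(- phi)%R, phi]) (f x)%:E = 0)%E.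
  move=> f0 mf fge0.
  rewrite -[RHS](integral0 lambda `[(- phi)%R, phi]%classic).
  apply: ge0_ae_eq_integral => //.
  - apply/measurable_EFinP; exact: (measurable_funS measurableT (@subsetT _ _)).
  - by move=> x _; rewrite lee_fin.
  exists M; split => // x /= H; apply: contrapT => xM; apply: H => xi.
  by rewrite f0.
have [x1 x1i ux1] : exists2 x, `[- phi, phi]%classic x & u x = 1.
  apply: contrapT => H.
  have : (value a b)%:E = 0%E.
    rewrite valueE; apply: ae0.
    - move=> x xi xM; have [ux1|ux0] := dich _ xi xM; last by rewrite -/u ux0.
      by exfalso; apply: H; exists x.
    - exact: measurable_win.
    - by move=> x; exact: win_ge0.
  by move=> [v0]; move: phia; rewrite v0 leNgt phi_gt0.
have [x2 [x2i x2M ux2]] : exists x, [/\ `[- phi, phi]%classic x, ~ M x & u x = 0].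
  apply: contrapT => H.
  have : (value b a)%:E = 0%E.
    rewrite -value_swap; apply: ae0.
    - move=> x xi xM; have [ux1'|ux0] := dich _ xi xM.
        by rewrite -/u ux1' subrr.
      by exfalso; apply: H; exists x.
    - apply: nondecreasing_measurable => // x y xy.
      have : 1 - u x <= 1 - u y by rewrite lerD2l lerN2 u_mono.
      rewrite le_eqVlt => /predU1P[->//|h]; apply/ltW/n_mono => //.
        by rewrite in_itv /=.
      by rewrite in_itv /=.
    - move=> x; have /andP[_ u1] := u01 x; rewrite -/u.
      move: u1; rewrite le_eqVlt => /predU1P[->|u1]; first by rewrite subrr n0.
      by rewrite -n0; apply/ltW/n_mono; rewrite ?in_itv /= ?lexx ?ler01// subr_gt0.
  by move=> [v0]; move: phib; rewrite v0 leNgt phi_gt0.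
(* [sup A] is the threshold above which the share is no longer [1]; a window of length [e]
   straddling it contradicts the constancy [Meq]. *)
pose A := [set x | `[- phi, phi]%classic x /\ u x = 1].
have A_le x : A x -> x <= x2.
  move=> [_ ux]; rewrite leNgt; apply/negP => /ltW/u_mono.
  by rewrite ux ux2 leNgt ltr01.
have hA : has_sup A by split; [exists x1|exists x2].
have tau_le : sup A <= x2 by apply: ge_sup; [exists x1|].
have tau_ge : x1 <= sup A by apply: ub_le_sup; [exists x2|].
(* The right end of the window: a share-zero point outside [M] less than [e] above [sup A], namely
   [x2] itself or a conull point just beyond the supremum. *)
have [x3 [x3M x3i x3lt ux3]] : exists x, [/\ ~ M x, `[- phi, phi]%classic x,
    x - e < sup A & u x = 0].
  move: tau_le; rewrite le_eqVlt => /predU1P[tau|tau].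
    by exists x2; split => //; rewrite tau gtrBl.
  have : sup A < Num.min x2 (sup A + e) by rewrite lt_min tau ltrDl e0.
  move=> /(itv_conull_point M0 mM)[z /andP[z1]]; rewrite lt_min => /andP[z2 z3] zM.
  have zi : `[- phi, phi]%classic z.
    move: x1i x2i; rewrite /= !in_itv /= => /andP[? ?] /andP[? ?].
    by apply/andP; split; lra.
  exists z; split => //; first by rewrite ltrBlDr.
  have [uz|//] := dich _ zi zM.
  have : z <= sup A by apply: ub_le_sup; [exists x2|].
  by rewrite leNgt z1.
have gap0 : 0 < sup A - (x3 - e) by rewrite subr_gt0.
(* [x4] has share [1] and lies above [x3 - e], so the share at [x3 - e] is at least [1], whereas
   [Meq] equates it with that at [x3]. *)
have [x4 [_ ux4]] := sup_adherent gap0 hA.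
rewrite opprB addrC subrK => /ltW/u_mono.
by rewrite ux4 Meq// ux3 leNgt ltr01.
Qed.

(** * Equilibria of the platform game *)

Section Equilibria.
Variable l : R.
Let k := fine (total_surplus P n Y).
Hypotheses (Kfin : total_surplus P n Y \is a fin_num) (Ssym : S^T = S).
Hypothesis l_ge0 : 0 <= l.
Hypothesis S_inj : forall v, v != 0 -> 0 < enorm (mulmxv S v).
Hypothesis S_le :
  forall v, dot (mulmxv S v) (mulmxv S v) <= l * dot v v.
Hypothesis k_le : k * Num.sqrt l <= r.

Let k_ge0 : 0 <= k.
Proof. by apply: fine_ge0; exact: total_surplus_ge0. Qed.

Lemma value_equilibrium a b :
  (forall y, value y b <= value a b) -> (forall y, value y a <= value b a) ->
  [/\ value a b = phi + enorm (a - b) ^+ 2, value b a = phi + enorm (a - b) ^+ 2 &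
      enorm (a - b) <= 2 * k * Num.sqrt l].
Proof.
move=> brA brB.
have ar := equilibrium_in_disc Kfin brA brB.
have br := equilibrium_in_disc Kfin brB brA.
have [||E1 E2 E3] :=
  @quadratic_equilibrium _ S k r l Ssym k_ge0 l_ge0 S_inj S_le k_le a b.
- by move=> y yr; have := brA y; rewrite !value_interior// lerD2l.
- by move=> y yr; have := brB y; rewrite !value_interior// lerD2l.
by rewrite !value_interior// E1 E2.
Qed.

Lemma principal_value_equilibrium e : enorm e = 1 ->
  enorm (mulmxv S e) = Num.sqrt l ->
  exists a b, [/\ forall y, value y b <= value a b,
    forall y, value y a <= value b a,
    value a b = phi + (2 * k * Num.sqrt l) ^+ 2 &
    value b a = phi + (2 * k * Num.sqrt l) ^+ 2].
Proof.
move=> e1 eS; have [ar opt val] :=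
  @principal_axis_equilibrium _ S k r l k_ge0 l_ge0 S_le k_le e e1 eS.
set a := _ *: e in ar opt val.
have ar' : enorm (- a) <= r by rewrite -[- a]add0r enormB subr0.
have e1' : enorm (- e) = 1 by rewrite -[- e]add0r enormB subr0.
have eS' : enorm (mulmxv S (- e)) = Num.sqrt l.
  by rewrite mulmxvN -[- _]add0r enormB subr0.
(* The optimality of the opponent is the same statement along [- e]. *)
have [_ opt' val'] :=
  @principal_axis_equilibrium _ S k r l k_ge0 l_ge0 S_le k_le (- e) e1' eS'.
rewrite scalerN -/a opprK in opt' val'.
have best b c : enorm b <= r -> enorm c <= r ->
    (forall y, quadratic_payoff S k y c <= quadratic_payoff S k b c) ->
    forall y, value y c <= value b c.
  move=> br cr H y; have [y' [yr yle _]] := value_project y.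
  by rewrite (le_trans (yle c))// !value_interior// lerD2l.
by exists a, (- a); split; [exact: best..|rewrite value_interior ?val|
  rewrite value_interior ?val'].
Qed.

End Equilibria.

End PlatformGame.

(** * Spherically symmetric laws *)

Section UniformShock.
Context {R : realType}.
Local Notation lambda := (@lebesgue_measure R).

(** Used with [c = nu 0], so that the remaining integrand takes values in [[0, 1]] even when [nu] is
    negative. *)
Lemma expectation_uniform_shift (phi : R) (phi_gt0 : 0 < phi) (c : R) (f : R -> R) :
  measurable_fun setT f -> (forall x, 0 <= f x <= 1) ->
  fine ('E_(uniform_prob (shock_range phi_gt0))[fun x => (c + f x)%R])%E =
  c + (2 * phi)^-1 * fine (\int[lambda]_(x in `[(- phi)%R, phi]) (f x)%:E)%E.
Proof.
move=> mf f01; rewrite unlock.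
set u := uniform_prob _.
have fi : u.-integrable setT (EFin \o f).
  apply: (@le_integrable _ _ _ u setT measurableT _ (cst 1%:E)).
  - exact/measurable_EFinP.
  - move=> x _ /=; have /andP[f0 f1] := f01 x; rewrite ger0_norm//.
    by rewrite normr1 lee_fin.
  - exact: finite_measure_integrable_cst.
transitivity (fine (\int[u]_x (c%:E + (f x)%:E))%E).
  by congr fine; apply: eq_integral => x _; rewrite EFinD.
rewrite integralD//; last exact: finite_measure_integrable_cst.
rewrite integral_cst//= probability_setT mule1.
rewrite integral_uniform//; last 2 first.
- exact/measurable_EFinP.
- by move=> x; rewrite lee_fin; have /andP[] := f01 x.
have fin : (\int[lambda]_(x in `[(- phi)%R, phi]) (f x)%:E)%E \is a fin_num.
  rewrite ge0_fin_numE; last first.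
    by apply: integral_ge0 => x _; rewrite lee_fin; have /andP[] := f01 x.
  apply: (@le_lt_trans _ _ (\int[lambda]_(x in `[(- phi)%R, phi]) cst 1%:E x)%E).
    apply: ge0_le_integral => //.
    - by move=> x _; rewrite lee_fin; have /andP[] := f01 x.
    - by apply/measurable_EFinP; apply: measurable_funS mf.
    - by move=> x _; rewrite lee_fin; have /andP[] := f01 x.
  rewrite integral_cst// mul1e /= lebesgue_measure_itv /=.
  by case: ifP; rewrite ltry.
rewrite -(fineK fin) -EFinM -EFinD /=; congr (_ + _^-1 * _); ring.
Qed.

End UniformShock.

Section PlaneMeasure.
Context {R : realType}.
Local Notation lambda := (@lebesgue_measure R).

Lemma measurable_dot (v : R * R) : measurable_fun setT (dot v).
Proof.
by apply: measurable_funD; apply: measurable_funM => //.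
Qed.

(** A vertical line is a product with a null factor; on any other line each vertical section is a
    single point. *)
Lemma line_null (v : R * R) (c : R) : v != 0 ->
  (lambda \x lambda)%E [set x | dot v x = c] = 0%E.
Proof.
move=> v0; have [v2|v2] := eqVneq v.2 0.
  have v1 : v.1 != 0.
    by apply: contra_neq v0 => v1; rewrite [v]surjective_pairing v1 v2.
  have -> : [set x | dot v x = c] = [set c / v.1] `*` setT.
    apply/seteqP; split => x /=; rewrite /dot v2 mul0r addr0.
      by move=> <-; split => //; field.
    by move=> [-> _]; field.
  by rewrite product_measure1E//= lebesgue_measure_set1 mul0e.
rewrite /product_measure1; apply: integral0_eq => x _ /=.
have -> : xsection [set x | dot v x = c] x = [set (c - v.1 * x) / v.2].
  apply/seteqP; split => y; rewrite /xsection /= ?inE /dot /=.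
    by move=> <-; field.
  by move=> ->; field.
exact: lebesgue_measure_set1.
Qed.

Context {d : measure_display} {T : measurableType d}.
Variable P : probability T R.
Variable Z : {RV P >-> (R * R)%type}.
Hypothesis Zsym : spherically_symmetric (distribution P Z).

(** [Q] is the rotation taking [w / |w|] to the first axis, so [dot w Z = |w| (Q Z).1] and [Q Z] has
    the law of [Z]. *)
Lemma spherical_projection (w : R * R) (A : set R) : measurable A ->
  P [set t | A (dot w (Z t))] = P [set t | A (enorm w * (Z t).1)].
Proof.
move=> mA; have [->|w0] := eqVneq w 0.
  by congr (P _); apply/seteqP; split => t /=;
    rewrite /dot enorm0 !mul0r addr0.
have nw : 0 < enorm w by rewrite enorm_gt0.
have nw2 : enorm w ^+ 2 = w.1 * w.1 + w.2 * w.2 by rewrite sqr_enorm.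
pose Q : 'M[R]_2 := \matrix_(i < 2, j < 2)
  ((if i == 0 then (if j == 0 then w.1 else w.2)
    else (if j == 0 then - w.2 else w.1)) / enorm w).
have Q1 : Q *m Q^T = 1%:M.
  apply: mx2P; rewrite mulmx2E !mxE /=.
  - transitivity ((w.1 * w.1 + w.2 * w.2) / enorm w ^+ 2); first by field; rewrite gt_eqF.
    by rewrite -nw2 divff// sqrf_eq0 gt_eqF.
  - by field; rewrite gt_eqF.
  - by field; rewrite gt_eqF.
  - transitivity ((w.1 * w.1 + w.2 * w.2) / enorm w ^+ 2); first by field; rewrite gt_eqF.
    by rewrite -nw2 divff// sqrf_eq0 gt_eqF.
have mB : measurable [set z : R * R | A (enorm w * z.1)].
  rewrite -[X in measurable X]setTI.
  have mf : measurable_fun setT (fun z : R * R => enorm w * z.1).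
    exact: measurable_funM.
  exact: mf.
have := Zsym Q1 mB; rewrite /distribution /pushforward /= => <-.
congr (P _); apply/seteqP; split => t /=; rewrite /mulmxv /= !mxE /=;
  rewrite (_ : enorm w * _ = dot w (Z t))// /dot; field; rewrite gt_eqF//.
Qed.

Lemma spherical_opp (A : set R) : measurable A ->
  P [set t | A (- (Z t).1)] = P [set t | A (Z t).1].
Proof.
move=> mA; have := spherical_projection (-1, 0) mA.
have -> : enorm (-1, 0) = 1 :> R.
  by rewrite /enorm /dot /= mulrNN mulr1 mul0r addr0 sqrtr1.
move=> H; transitivity (P [set t | A (dot (-1, 0) (Z t))]).
  by congr (P _); apply/seteqP; split => t /=; rewrite /dot /= mul0r addr0 mulN1r.
by rewrite H; congr (P _); apply/seteqP; split => t /=; rewrite mul1r.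
Qed.

End PlaneMeasure.

(** * Elliptical electorates *)

Section EllipticalElectorate.
Context {R : realType} {d : measure_display} {T : measurableType d}.
Variable P : probability T R.
Variable Z : {RV P >-> (R * R)%type}.
Hypothesis Zsym : spherically_symmetric (distribution P Z).
Variables (mu : R * R) (s1 s2 c : R).
Hypotheses (s1_gt0 : 0 < s1) (s2_gt0 : 0 < s2) (c_lt1 : `|c| < 1).
Hypothesis reg : regular_electorate (electorate P Z mu s1 s2 c).

Let S := sqrtmx (covmx s1 s2 c).
Let X t := mulmxv S (Z t).
Let Y t := (Z t).1.
Let m := electorate P Z mu s1 s2 c.
Let r := support_radius mu m.
Let l := top_eigenvalue s1 s2 c.

Let Ssym : S^T = S.
Proof. by case: (sqrtmx_covmx s1_gt0 s2_gt0 c_lt1). Qed.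

Let dot_S v : dot (mulmxv S v) (mulmxv S v) = dot v (mulmxv (covmx s1 s2 c) v).
Proof.
have [_ <-] := sqrtmx_covmx s1_gt0 s2_gt0 c_lt1.
by rewrite -/S dot_mulmxv mulmxvM Ssym.
Qed.

Lemma sqrt_covmx_inj v : v != 0 -> 0 < enorm (mulmxv S v).
Proof.
by move=> v0; rewrite /enorm sqrtr_gt0 dot_S; exact: dot_covmx_gt0.
Qed.

Lemma sqrt_covmx_le v : dot (mulmxv S v) (mulmxv S v) <= l * dot v v.
Proof. by rewrite dot_S; exact: dot_covmx_le. Qed.

Lemma sqrt_covmx_top : exists e, enorm e = 1 /\ enorm (mulmxv S e) = Num.sqrt l.
Proof.
have [e [e1 eE]] := top_eigenvector s1 s2 c.
by exists e; split => //; rewrite /enorm dot_S eE.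
Qed.

Let dotX v t : dot v (X t) = dot (mulmxv S v) (Z t).
Proof. by rewrite dot_mulmxv Ssym. Qed.

Lemma measurable_dot_voter v : measurable_fun setT (fun t => dot v (X t)).
Proof.
rewrite (_ : (fun _ => _) = dot (mulmxv S v) \o Z); last first.
  by apply/funext => t; rewrite /= dotX.
by apply: measurableT_comp => //; exact: measurable_dot.
Qed.

Lemma measurable_fst_voter : measurable_fun setT Y.
Proof. exact: (measurableT_comp measurable_fst). Qed.

Lemma voter_projection v (A : set R) : measurable A ->
  P [set t | A (dot v (X t))] = P [set t | A (enorm (mulmxv S v) * Y t)].
Proof.
move=> mA; rewrite -(spherical_projection Zsym)//; congr (P _).
by apply/seteqP; split => t /=; rewrite dotX.
Qed.

Lemma voter_upper_prob v y : upper_prob P (fun t => dot v (X t)) y =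
  upper_prob P (fun t => enorm (mulmxv S v) * Y t) y.
Proof.
rewrite /upper_prob; congr fine.
have := @voter_projection v `[y, +oo[%classic (measurable_itv _).
by rewrite /= => H; transitivity (P [set t | `[y, +oo[%classic (dot v (X t))]);
  [congr (P _); apply/seteqP; split => t /=; rewrite in_itv /= andbT|
   rewrite H; congr (P _); apply/seteqP; split => t /=; rewrite in_itv /= andbT].
Qed.

Lemma voter_atomless v y : v != 0 -> P [set t | dot v (X t) = y] = 0%E.
Proof.
move=> v0; have [/null_content_dominatesP ac _ _] := reg.
have := ac [set x | dot v x = dot v mu + y] _ (line_null _ v0).
rewrite /electorate /pushforward => <-; last first.
  by apply: measurable_eq; exact: measurable_dot.
congr (P _); apply/seteqP; split => t /=; rewrite dotDr -/S -/(X t).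
  by move=> ->.
by move/addrI.
Qed.

Let v1_neq0 : ((1, 0) : R * R) != 0.
Proof. by rewrite -pair_eqE /= negb_and oner_eq0. Qed.

(** Absolute continuity is known for the electorate, hence for projections of [X]; it is carried
    over to [Y] along the first axis, where [|S v| > 0]. *)
Lemma fst_atomless y : P [set t | Y t = y] = 0%E.
Proof.
have s0 := sqrt_covmx_inj v1_neq0.
rewrite -(voter_atomless (enorm (mulmxv S (1, 0)) * y) v1_neq0).
have := @voter_projection (1, 0) [set enorm (mulmxv S (1, 0)) * y] (measurable_set1 _).
rewrite /= => ->; congr (P _); apply/seteqP; split => t /=; first by move=> ->.
by apply: mulfI; rewrite gt_eqF.
Qed.

Lemma fst_sym y : P [set t | Y t < - y] = P [set t | y < Y t].
Proof.
have := @spherical_opp _ _ _ _ _ Zsym `]y, +oo[%classic (measurable_itv _).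
move=> H; transitivity (P [set t | `]y, +oo[%classic (- (Z t).1)]).
  by congr (P _); apply/seteqP; split => t /=; rewrite in_itv /= andbT ltrNr.
by rewrite H; congr (P _); apply/seteqP; split => t /=; rewrite in_itv /= andbT.
Qed.

Let mF : measurable_fun setT (fun t => mu + X t).
Proof.
have E : (fun t => mu + X t) =
    (fun t => (mu.1 + dot (1, 0) (X t), mu.2 + dot (0, 1) (X t))).
  by apply/funext => t; congr pair; rewrite /dot /=; ring.
rewrite E; apply: measurable_fun_pair; apply: measurable_funD => //;
  exact: measurable_dot_voter.
Qed.

Lemma voter_support : exists N, [/\ measurable N, P N = 0%E &
  forall t, ~ N t -> law_support m (mu + X t)].
Proof.
apply: (law_support_full (P := P) rat_box_basis) => // i.
rewrite -[X in measurable X]setTI; apply: mF => //.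
by apply: measurableX; exact: measurable_itv.
Qed.

(** Without this, [sup] could be a default value and [support_radius] would bound nothing. Full mass
    makes the support nonempty, compactness makes it bounded. *)
Lemma support_radius_has_sup : has_sup [set enorm (x - mu) | x in law_support m].
Proof.
split.
  have [N [mN N0 HN]] := voter_support.
  have [t nNt] : exists t, ~ N t.
    apply: contrapT => H; have NT : N = setT.
      by apply/seteqP; split => // t _; apply: contrapT => nN; apply: H; exists t.
    by move: N0; rewrite NT probability_setT => -[] /eqP; rewrite oner_eq0.
  by exists (enorm (mu + X t - mu)), (mu + X t) => //; exact: HN.
have [_ /compact_bounded[M [_ HM]] _] := reg.
(* [M] bounds the sup norm; the factor [2] exceeds the [sqrt 2] lost in passing to the Euclidean
   norm. *)
exists (2 * (`|M| + 1 + `|mu.1| + `|mu.2|)) => _ [x /HM xM <-].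
have : Num.max `|x.1| `|x.2| <= `|M| + 1.
  by apply: (xM (`|M| + 1)); rewrite ltr_pwDr// ler_norm.
rewrite ge_max => /andP[x1 x2].
rewrite enorm_le ?mulr_ge0 ?addr_ge0//.
set B := _ + _ + _ + _.
have b1 : `|x.1 - mu.1| <= B.
  by apply: le_trans (ler_normB _ _) _; rewrite /B; have := normr_ge0 mu.2; lra.
have b2 : `|x.2 - mu.2| <= B.
  by apply: le_trans (ler_normB _ _) _; rewrite /B; have := normr_ge0 mu.1; lra.
have B0 : 0 <= B by exact: le_trans b1.
have q1 : (x.1 - mu.1) ^+ 2 <= B ^+ 2.
  by rewrite -(real_normK (num_real (_ - _))) lerXn2r ?nnegrE.
have q2 : (x.2 - mu.2) ^+ 2 <= B ^+ 2.
  by rewrite -(real_normK (num_real (_ - _))) lerXn2r ?nnegrE.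
rewrite /dot /= -!expr2 exprMn; have := sqr_ge0 B; lra.
Qed.

Lemma support_radius_ge0 : 0 <= r.
Proof.
have [[u [x xs xu]] ub] := support_radius_has_sup.
by apply: (@le_trans _ _ u); [rewrite -xu enorm_ge0|apply: ub_le_sup => //; exists x].
Qed.

Lemma voter_bounded : exists N, [/\ measurable N, P N = 0%E &
  forall t, ~ N t -> enorm (X t) <= r].
Proof.
have [N [mN N0 HN]] := voter_support; exists N; split => // t /HN Ht.
apply: ub_le_sup; first by case: support_radius_has_sup.
by exists (mu + X t) => //; rewrite addrC addKr.
Qed.

(** If mass lay both below [x] and above [y], the interval from [x] to [y] would be between the
    extrema of the support, where the cdf is strictly increasing. *)
Lemma voter_gapless v x y : v != 0 -> x < y ->
  upper_prob P (fun t => dot v (X t)) x = upper_prob P (fun t => dot v (X t)) y ->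
  upper_prob P (fun t => dot v (X t)) x = 1 \/
  upper_prob P (fun t => dot v (X t)) y = 0.
Proof.
move=> v0 xy; set u := upper_prob P _ => uxy.
have mW := measurable_dot_voter v.
have nv : 0 < enorm v by rewrite enorm_gt0.
pose e := (enorm v)^-1 *: v.
have e1 : enorm e = 1.
  by rewrite enormZ ger0_norm ?invr_ge0 ?enorm_ge0// mulVf// gt_eqF.
have [_ _ /(_ e e1) incr] := reg.
pose G t := dot e (mu + X t); set p := projection_law m e.
have mG : measurable_fun setT G.
  exact: (measurableT_comp (measurable_dot e) mF).
have GE t : G t = dot v (X t) / enorm v + dot e mu.
  by rewrite /G dotDr [dot e (X t)]dotZl mulrC addrC.
(* Converts a threshold for [dot v X] into one for the projection of the uncentered electorate on
   the unit vector [e]. *)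
pose sc z := z / enorm v + dot e mu.
have G_le t z : (G t <= sc z) = (dot v (X t) <= z).
  by rewrite GE /sc lerD2r ler_pM2r// invr_gt0.
have le_G t z : (sc z <= G t) = (z <= dot v (X t)).
  by rewrite GE /sc lerD2r ler_pM2r// invr_gt0.
have m_le z : measurable [set t | dot v (X t) <= z].
  have -> : [set t | dot v (X t) <= z] = ~` [set t | z < dot v (X t)].
    by apply/seteqP; split => t /=; rewrite leNgt => /negP.
  by apply: measurableC; exact: measurable_gt.
(* The cdf includes the threshold and so does [u]; atomlessness reconciles the two. *)
have fE z : fine (P [set t | dot v (X t) <= z]) = 1 - u z.
  rewrite /u /upper_prob -fine_probC; last exact: measurable_ge.
  have -> : ~` [set t | z <= dot v (X t)] = [set t | dot v (X t) < z].
    by apply/seteqP; split => t /=; rewrite ltNge => /negP.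
  apply/eqP; rewrite eq_le; apply/andP; split; last first.
    apply: (@fine_prob_ae_le _ _ _ P set0) => //; first exact: measurable_lt.
    by move=> t /= /ltW; left.
  apply: (@fine_prob_ae_le _ _ _ P _ _ _ _ (voter_atomless z v0)) => //.
  - exact: measurable_eq.
  - exact: measurable_lt.
  by move=> t /=; rewrite le_eqVlt => /predU1P[|]; [right|left].
have pE z : p `]-oo, sc z]%classic = (1 - u z)%:E.
  rewrite -fE fine_prob//; congr (P _); apply/seteqP; split => t /=;
  by rewrite in_itv /= -/(X t) -/(G t) G_le.
have [N1 [mN1 N10 N1G]] : exists N, [/\ measurable N, P N = 0%E &
    forall t, ~ N t -> law_support p (G t)].
  apply: (law_support_full (P := P) rat_itv_basis) => // i.
  rewrite -[X in measurable X]setTI; apply: mG => //; exact: measurable_itv.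
have [N [mN N0 NX]] := voter_bounded.
(* Boundedness makes [inf] and [sup] of the support genuine bounds instead of default values. *)
have p_bounded z : law_support p z -> `|z - dot e mu| <= r.
  move=> zs; rewrite leNgt; apply/negP => rz.
  have e0 : 0 < `|z - dot e mu| - r by rewrite subr_gt0.
  have := zs _ (ball_open (z : R^o) _) (ballxx z e0).
  rewrite (_ : p _ = 0%E) ?ltxx//.
  have mA : measurable [set t | ball z (`|z - dot e mu| - r) (G t)].
    rewrite -[X in measurable X]setTI; apply: mG => //.
    exact: measurable_ball.
  rewrite -[LHS](fine_prob P mA); apply/eqP; rewrite eqe; apply: contrapT => /negP A0.
  have [t /= zt nN] := prob_gt0_point mN N0 mA A0.
  have h : `|dot e (X t)| <= r.
    rewrite ler_norml; apply/andP; split.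
      rewrite lerNl -mulN1r -dotZl; apply: le_trans (dot_le_enorm _ _) _.
      by rewrite enormZ e1 normrN1 !mul1r; exact: NX.
    by apply: le_trans (dot_le_enorm _ _) _; rewrite e1 mul1r; exact: NX.
  have GX : G t = dot e mu + dot e (X t) by rewrite /G dotDr.
  move: zt; rewrite /ball /= GX ltrBrDl.
  have := ler_normD (z - (dot e mu + dot e (X t))) (dot e (X t)).
  have -> : z - (dot e mu + dot e (X t)) + dot e (X t) = z - dot e mu by ring.
  by move=> h1; rewrite ltNge => /negP; apply; apply: le_trans h1 _; lra.
apply: contrapT => /not_orP[ux uy].
have lbp : has_lbound (law_support p).
  exists (dot e mu - r) => z /p_bounded; rewrite ler_norml => /andP[? _]; lra.
have ubp : has_ubound (law_support p).
  exists (dot e mu + r) => z /p_bounded; rewrite ler_norml => /andP[_ ?]; lra.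
(* [t1] and [t2] supply support points on the two sides, giving [inf <= sc x] and [sc y <= sup]. *)
have [t1 t1x t1N] : exists2 t, dot v (X t) <= x & ~ N1 t.
  apply: (prob_gt0_point mN1 N10 (m_le x)).
  by rewrite fE subr_eq0 eq_sym; apply/eqP.
have [t2 t2y t2N] : exists2 t, y <= dot v (X t) & ~ N1 t.
  apply: (prob_gt0_point mN1 N10 (measurable_ge y mW)); exact/eqP.
suff : (p `]-oo, sc x]%classic < p `]-oo, sc y]%classic)%E.
  by rewrite !pE uxy ltxx.
apply: incr.
- apply: (@le_trans _ _ (G t1)); last by rewrite G_le.
  by apply: ge_inf => //; exact: N1G.
- by rewrite /sc ltrD2r ltr_pM2r// invr_gt0.
- apply: (@le_trans _ _ (G t2)); first by rewrite le_G.
  by apply: ub_le_sup => //; exact: N1G.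
Qed.

(** * Bounds on the total surplus of the standardized projection *)

Section Surplus.
Variable n : R -> R.
Hypotheses (n0 : n 0 = 0) (n1 : n 1 = 1).
Hypothesis n_mono : {in `[0, 1] &, {homo n : s t / s < t}}.
Hypothesis n_concave : forall p, 0 < p < 1 -> 1 < n p + n (1 - p).

(** Along a top eigenvector [e], [dot e X] is distributed as [sqrt l Y] and is at most [r] almost
    surely, so [Y] has no mass beyond [r / sqrt l]. *)
Lemma voter_surplus_le : (total_surplus P n Y <= (r / Num.sqrt l)%:E)%E.
Proof.
have l0 : 0 < Num.sqrt l by rewrite sqrtr_gt0 top_eigenvalue_gt0.
have [e [e1 eS]] := sqrt_covmx_top.
have [N [mN N0 NX]] := voter_bounded.
apply: (total_surplus_le n0 n1 n_mono n_concave measurable_fst_voter).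
  by rewrite divr_ge0 ?support_radius_ge0// ltW.
move=> y; rewrite ltr_pdivrMr// => ry.
have -> : upper_prob P Y y = upper_prob P (fun t => dot e (X t)) (y * Num.sqrt l).
  rewrite voter_upper_prob eS /upper_prob; congr (fine (P _)).
  by apply/seteqP; split => t /=; rewrite mulrC ler_pM2l.
apply/eqP; apply: contrapT => /negP up0.
have mA := measurable_ge (y * Num.sqrt l) (measurable_dot_voter e).
have [t /= yt nN] := prob_gt0_point mN N0 mA up0.
have := dot_le_enorm e (X t); rewrite e1 mul1r => h.
by have := lt_le_trans ry (le_trans yt (le_trans h (NX _ nN))); rewrite ltxx.
Qed.

(** Symmetry and absence of an atom at [0] give [Y] positive mass on both sides. The right side
    provides some [1 / (k + 1)] with positive tail probability, the left side keeps tail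
    probabilities at positive thresholds below [1]. *)
Lemma voter_surplus_gt0 : (0 < total_surplus P n Y)%E.
Proof.
have mY := measurable_fst_voter.
have sym0 : P [set t | Y t < 0] = P [set t | 0 < Y t].
  by have := fst_sym 0; rewrite oppr0.
have pos0 : fine (P [set t | 0 < Y t]) != 0.
  apply/eqP => pos.
  have mgt := measurable_gt 0 mY; have mlt := measurable_lt 0 mY.
  have meq := measurable_eq 0 mY.
  have pos' : P [set t | 0 < Y t] = 0%E by rewrite -(fine_prob P mgt) pos.
  have neg' : P [set t | Y t < 0] = 0%E by rewrite sym0.
  have mN : measurable ([set t | 0 < Y t] `|` [set t | Y t < 0]) by exact: measurableU.
  have N0 : P ([set t | 0 < Y t] `|` [set t | Y t < 0]) = 0%E.
    by apply: null_set_setU.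
  have : fine (P [set: T]) != 0 by rewrite probability_setT /= oner_eq0.
  have mU := measurableU _ _ mN meq.
  have U0 := null_set_setU mN meq N0 (fst_atomless 0).
  move=> /(prob_gt0_point mU U0 measurableT)[t _].
  by apply; case: (ltgtP (Y t) 0) => h; [left; right|left; left|right].
have [k k0] : exists k, upper_prob P Y k.+1%:R^-1 != 0.
  apply: contrapT => H; move/eqP: pos0; apply.
  have mA k : measurable [set t | (k.+1%:R^-1 : R) <= Y t] by exact: measurable_ge.
  have -> : [set t | 0 < Y t] = \bigcup_k [set t | (k.+1%:R^-1 : R) <= Y t].
    apply/seteqP; split => t /=; last first.
      by move=> [k _ /=]; apply: lt_le_trans; rewrite invr_gt0.
    move=> Yt; exists (Num.truncn (Y t)^-1) => //=.
    by rewrite invf_ple ?posrE ?invr_gt0//; exact/ltW/truncnS_gt.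
  rewrite (_ : P _ = 0%E)//.
  apply/negligibleP; first exact: bigcupT_measurable.
  apply: negligible_bigcup => k; apply/negligibleP => //.
  rewrite -[LHS](fine_prob P (mA k)); congr EFin; apply: contrapT => /eqP h.
  by apply: H; exists k.
apply: (total_surplus_gt0 n0 n1 n_mono n_concave mY (_ : 0 < k.+1%:R^-1)).
- by rewrite invr_gt0.
- by rewrite lt_def k0; have /andP[] := upper_prob01 P k.+1%:R^-1 mY.
move=> y y0; rewrite -subr_gt0 -(fine_probC P (measurable_ge y mY)).
have mC := measurableC (measurable_ge y mY).
have mlt := measurable_lt 0 mY.
apply: (@lt_le_trans _ _ (fine (P [set t | Y t < 0]))).
  rewrite sym0 lt_def pos0.
  by have /andP[] := fine_prob01 P (measurable_gt 0 mY).
apply: (@fine_prob_ae_le _ _ _ P set0) => // t /= Yt; left => /= yY.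
by have := lt_trans (le_lt_trans yY Yt) y0; rewrite ltxx.
Qed.

End Surplus.

Lemma share_margin a b x :
  share_A m a b x = upper_prob P (margin X (a - mu) (b - mu)) x.
Proof.
rewrite /share_A /upper_prob; congr (fine (P _)).
have E u t : enorm (u - (mu + X t)) ^+ 2 = dot (u - mu - X t) (u - mu - X t).
  by rewrite sqr_enorm; congr dot; rewrite opprD addrA.
by apply/seteqP; split => t; rewrite /= -/S -/(X t) !E.
Qed.

End EllipticalElectorate.

(** * Equilibrium payoffs *)

Section EquilibriumPayoffs.
Context {R : realType} {d : measure_display} {T : measurableType d}.
Variable P : probability T R.
Variable Z : {RV P >-> (R * R)%type}.
Hypothesis Zsym : spherically_symmetric (distribution P Z).
Variables (mu : R * R) (s1 s2 phi : R) (nu : R -> R).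
Hypotheses (s1_gt0 : 0 < s1) (s2_gt0 : 0 < s2) (phi_gt0 : 0 < phi).
Hypothesis nu_norm : nu 1 - nu 0 = 1.
Hypothesis nu_mono : {in `[0, 1] &, {homo nu : s t / s < t}}.
Hypothesis nu_concave :
  forall p, 0 < p < 1 -> nu 0 + nu 1 < nu p + nu (1 - p).

Let n s := nu s - nu 0.
Let Y t := (Z t).1.

(** The constant [k]. It depends on [P], [Z] and [nu] but not on the correlation [c], so it is
    shared by the two electorates compared. *)
Definition surplus_scale : R := fine (total_surplus P n Y).

Let n0 : n 0 = 0. Proof. exact: subrr. Qed.

Let n_mono : {in `[0, 1] &, {homo n : s t / s < t}}.
Proof. by move=> s t si ti st; rewrite ltrD2r nu_mono. Qed.

Let n_concave p : 0 < p < 1 -> 1 < n p + n (1 - p).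
Proof. by move=> /nu_concave; rewrite /n; move: nu_norm; lra. Qed.

Let n01 p : 0 <= p <= 1 -> 0 <= n p <= 1.
Proof.
have i0 : (0 : R) \in `[0, 1] by rewrite in_itv /= lexx ler01.
have i1 : (1 : R) \in `[0, 1] by rewrite in_itv /= lexx ler01.
move=> pi; have pin : p \in `[0, 1] by rewrite in_itv.
have /andP[p0 p1] := pi; apply/andP; split.
  move: p0; rewrite le_eqVlt => /predU1P[<-|p0]; first by rewrite n0.
  by rewrite -n0 ltW// n_mono.
rewrite -nu_norm; move: p1; rewrite le_eqVlt => /predU1P[->//|p1].
exact/ltW/n_mono.
Qed.

Variable c : R.
Hypothesis c_lt1 : `|c| < 1.
Let m := electorate P Z mu s1 s2 c.
Hypothesis reg : regular_electorate m.
Let S := sqrtmx (covmx s1 s2 c).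
Let X t := mulmxv S (Z t).
Let r := support_radius mu m.
Let l := top_eigenvalue s1 s2 c.
Hypothesis r_phi : 4 * r ^+ 2 < phi.

Let mX v : measurable_fun setT (fun t => dot v (X t)).
Proof. exact: measurable_dot_voter. Qed.

Let l_gt0 : 0 < Num.sqrt l.
Proof. by rewrite sqrtr_gt0 top_eigenvalue_gt0. Qed.

Lemma surplus_scale_fin : total_surplus P n Y \is a fin_num.
Proof.
have gt0 := voter_surplus_gt0 Zsym s1_gt0 s2_gt0 c_lt1 reg n0 nu_norm n_mono n_concave.
have le := voter_surplus_le Zsym s1_gt0 s2_gt0 c_lt1 reg n0 nu_norm n_mono n_concave.
by rewrite ge0_fin_numE; [apply: le_lt_trans le _; rewrite ltry|exact: ltW].
Qed.

Lemma surplus_scale_gt0 : 0 < surplus_scale.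
Proof.
rewrite -lte_fin /surplus_scale fineK ?surplus_scale_fin//.
exact: (voter_surplus_gt0 Zsym s1_gt0 s2_gt0 c_lt1 reg n0 nu_norm n_mono n_concave).
Qed.

Let scale_le : surplus_scale * Num.sqrt l <= r.
Proof.
rewrite -ler_pdivlMr// -lee_fin /surplus_scale fineK ?surplus_scale_fin//.
exact: (voter_surplus_le Zsym s1_gt0 s2_gt0 c_lt1 reg n0 nu_norm n_mono n_concave).
Qed.

Let VA := payoff_A m phi_gt0 nu.
Let VB := payoff_B m phi_gt0 nu.
Let V := value P n phi X.

Let VAE a b : VA a b = nu 0 + (2 * phi)^-1 * V (a - mu) (b - mu).
Proof.
have mM := measurable_margin mX (a - mu) (b - mu).
have := @expectation_uniform_shift R phi phi_gt0 (nu 0)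
  (n \o upper_prob P (margin X (a - mu) (b - mu))) (measurable_win P n_mono mM).
rewrite /V /value /shock_value => <-; last first.
  by move=> x; apply: n01; exact: upper_prob01.
rewrite /VA /payoff_A; congr (fine (expectation _ _)); apply/funext => x /=.
by rewrite share_margin /n [RHS]addrC subrK.
Qed.

Let atomless v y : v != 0 -> P [set t | dot v (X t) = y] = 0%E.
Proof. exact: (voter_atomless reg). Qed.

Let VBE a b : VB a b = nu 0 + (2 * phi)^-1 * V (b - mu) (a - mu).
Proof.
have mM := measurable_margin mX (a - mu) (b - mu).
have onem x : 0 <= 1 - upper_prob P (margin X (a - mu) (b - mu)) x <= 1.
  by have /andP[? ?] := upper_prob01 P x mM; apply/andP; split; lra.
have mf : measurable_fun setT
    (fun x => n (1 - upper_prob P (margin X (a - mu) (b - mu)) x)).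
  apply: nondecreasing_measurable => // x y xy.
  have : 1 - upper_prob P (margin X (a - mu) (b - mu)) x <=
      1 - upper_prob P (margin X (a - mu) (b - mu)) y.
    by rewrite lerD2l lerN2; exact: upper_prob_nonincreasing.
  rewrite le_eqVlt => /predU1P[->//|h].
  by apply/ltW/n_mono => //; rewrite in_itv /=.
have := @expectation_uniform_shift R phi phi_gt0 (nu 0) _ mf.
rewrite (value_swap phi n0 nu_norm n_mono mX atomless) /= => <-; last first.
  by move=> x; exact: n01.
rewrite /VB /payoff_B; congr (fine (expectation _ _)); apply/funext => x /=.
by rewrite share_margin /n [RHS]addrC subrK.
Qed.

(** Common payoff of both parties at an equilibrium with platform distance [D]. *)
Definition symmetric_payoff (D : R) : R := nu 0 + (2 * phi)^-1 * (phi + D ^+ 2).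

Let phi2_gt0 : 0 < (2 * phi)^-1.
Proof. by rewrite invr_gt0 mulr_gt0. Qed.

Let gapless v x y : v != 0 -> x < y ->
  upper_prob P (fun t => dot v (X t)) x = upper_prob P (fun t => dot v (X t)) y ->
  upper_prob P (fun t => dot v (X t)) x = 1 \/
  upper_prob P (fun t => dot v (X t)) y = 0.
Proof. exact: (voter_gapless s1_gt0 s2_gt0 c_lt1 reg). Qed.

Let Ssym : S^T = S.
Proof. by case: (sqrtmx_covmx s1_gt0 s2_gt0 c_lt1). Qed.

Lemma nash_payoffs xA xB : nash_equilibrium VA VB xA xB ->
  [/\ VA xA xB = symmetric_payoff (enorm (xA - xB)),
      VB xA xB = symmetric_payoff (enorm (xA - xB)) &
      enorm (xA - xB) <= 2 * surplus_scale * Num.sqrt l].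
Proof.
move=> [brA brB]; have [N [mN N0 NX]] := voter_bounded s1_gt0 s2_gt0 c_lt1 reg.
have dE : xA - xB = (xA - mu) - (xB - mu) by rewrite opprB addrA subrK.
have [] := @value_equilibrium _ _ _ P n phi phi_gt0 n0 nu_norm n_mono n_concave
  X Y S r N mX (measurable_fst_voter Z) mN N0 NX
  (support_radius_ge0 s1_gt0 s2_gt0 c_lt1 reg)
  r_phi (voter_upper_prob Zsym s1_gt0 s2_gt0 c_lt1) atomless
  (fst_atomless Zsym s1_gt0 s2_gt0 c_lt1 reg) (fst_sym Zsym) gapless
  l surplus_scale_fin Ssym (ltW (top_eigenvalue_gt0 _ _ s1_gt0))
  (sqrt_covmx_inj s1_gt0 s2_gt0 c_lt1) (sqrt_covmx_le s1_gt0 s2_gt0 c_lt1)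
  scale_le (xA - mu) (xB - mu).
- move=> y; have := brA (y + mu); rewrite !VAE addrK lerD2l ler_pM2l//.
- move=> y; have := brB (y + mu); rewrite !VBE addrK lerD2l ler_pM2l//.
by rewrite -dE => E1 E2 E3; split => //; rewrite ?VAE ?VBE /V ?E1 ?E2.
Qed.

(** Attains the bound of [nash_payoffs]; the payoff of [A] at this equilibrium bounds the
    party-preferred distance from below. *)
Lemma principal_nash : exists xA xB, nash_equilibrium VA VB xA xB /\
  VA xA xB = symmetric_payoff (2 * surplus_scale * Num.sqrt l).
Proof.
have [N [mN N0 NX]] := voter_bounded s1_gt0 s2_gt0 c_lt1 reg.
have [e [e1 eS]] := sqrt_covmx_top s1_gt0 s2_gt0 c_lt1.
have [a [b [brA brB VE _]]] := @principal_value_equilibrium _ _ _ P n phi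
  n0 nu_norm n_mono n_concave
  X Y S r N mX (measurable_fst_voter Z) mN N0 NX
  (support_radius_ge0 s1_gt0 s2_gt0 c_lt1 reg)
  r_phi (voter_upper_prob Zsym s1_gt0 s2_gt0 c_lt1)
  (fst_atomless Zsym s1_gt0 s2_gt0 c_lt1 reg) (fst_sym Zsym)
  l surplus_scale_fin (ltW (top_eigenvalue_gt0 _ _ s1_gt0))
  (sqrt_covmx_le s1_gt0 s2_gt0 c_lt1)
  scale_le e e1 eS.
exists (a + mu), (b + mu); split; last by rewrite VAE !addrK /V VE.
by split => y; rewrite ?VAE ?VBE !addrK lerD2l ler_pM2l.
Qed.

End EquilibriumPayoffs.

Theorem corollary1 (R : realType) (d : measure_display) (T : measurableType d)
    (P : probability T R) (Z : {RV P >-> (R * R)%type})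
    (Zsym : spherically_symmetric (distribution P Z))
    (Zcov : identity_covariance P Z)
    (mu : R * R) (s1 s2 : R) (s1_gt0 : 0 < s1) (s2_gt0 : 0 < s2)
    (reg : forall r : R, `|r| < 1 ->
       regular_electorate (electorate P Z mu s1 s2 r))
    (phi : R) (phi_gt0 : 0 < phi)
    (rho U : R -> R) (rhoP : power_rule rho)
    (UP : utility_on (rho 0) (rho 1) U)
    (nu_norm : (U \o rho) 1 - (U \o rho) 0 = 1) :
  let m := electorate P Z mu s1 s2 in
  let VA r := payoff_A (m r) phi_gt0 (U \o rho) in
  let VB r := payoff_B (m r) phi_gt0 (U \o rho) in
  forall r r' : R, `|r| < 1 -> `|r'| < 1 ->
    4 * support_radius mu (m r) ^+ 2 < phi ->
    4 * support_radius mu (m r') ^+ 2 < phi ->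
    `|r| < `|r'| ->
  forall xA xB yA yB : R * R,
    party_preferred (VA r) (VB r) xA xB ->
    party_preferred (VA r') (VB r') yA yB ->
  [/\ enorm (xA - xB) < enorm (yA - yB),
      VA r xA xB < VA r' yA yB &
      VB r xA xB < VB r' yA yB].
Proof.
move=> m VA VB r r' r1 r1' rphi rphi' rr' xA xB yA yB [xNE _] [yNE yPP].
have mono := utility_rule_mono rhoP UP.
have conc := utility_rule_concave rhoP UP.
have [xVA xVB xD] := nash_payoffs Zsym s1_gt0 s2_gt0 nu_norm mono conc r1
  (reg r r1) rphi xNE.
have [yVA yVB _] := nash_payoffs Zsym s1_gt0 s2_gt0 nu_norm mono conc r1'
  (reg r' r1') rphi' yNE.
have [zA [zB [zNE zVA]]] := principal_nash Zsym s1_gt0 s2_gt0 phi_gt0 nu_norm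
  mono conc r1' (reg r' r1') rphi'.
have k0 := surplus_scale_gt0 Zsym s1_gt0 s2_gt0 nu_norm mono conc r1 (reg r r1).
have phi2 : 0 < (2 * phi)^-1 by rewrite invr_gt0 mulr_gt0.
have xy : enorm (xA - xB) < enorm (yA - yB).
  (* Payoffs increase with distance, so preference over the principal-axis equilibrium gives
     [2 k sqrt l(r') <= |yA - yB|], while [|xA - xB| <= 2 k sqrt l(r)] with the same [k > 0]. *)
  have [zy _] := yPP _ _ zNE; move: zy.
  rewrite /VA zVA yVA /symmetric_payoff lerD2l ler_pM2l// lerD2l.
  rewrite ler_pXn2r ?nnegrE ?enorm_ge0//; last first.
    by rewrite !mulr_ge0 ?sqrtr_ge0 ?(ltW k0).
  apply: lt_le_trans; apply: le_lt_trans xD _.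
  rewrite ltr_pM2l ?mulr_gt0// ltr_sqrt ?top_eigenvalue_gt0//.
  exact: top_eigenvalue_lt.
have V_lt : symmetric_payoff phi (U \o rho) (enorm (xA - xB)) <
    symmetric_payoff phi (U \o rho) (enorm (yA - yB)).
  by rewrite /symmetric_payoff ltrD2l ltr_pM2l// ltrD2l ltrXn2r// enorm_ge0.
by rewrite /VA /VB xVA xVB yVA yVB.
Qed.
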